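(* Let $B\subset W$ be a good lattice, $l=l(B)$, and $A$ a self-dual lattice with $B\subset A\subset B^*$. (i) The Hilbert space $\mathcal{H}^A_\psi$ is the Hilbert sum of the subspaces $\mathcal{E}^B_{n,j}$, $n\in\mathbb{N}$, $j=0,1,2$. The subspace $\mathcal{E}^B_{0,0}$ is non-zero. The subspaces $\mathcal{E}^{B,\pm}_{n,0}$, $n\ge1$, and $\mathcal{E}^{B,\pm}_{n,2}$, $n\geq0$, are non-zero if and only if $l>0$. The subspaces $\mathcal{E}^{B,\pm}_{n,1}$, $n\ge0$, are non-zero if and only if $l<r$. (ii) When non-zero, the subspaces $\mathcal{E}^B_{0,0}$, $\mathcal{E}^{B,\pm}_{n,0}$ ($n\ge1$), $\mathcal{E}^{B,\pm}_{n,j}$ ($n\ge0$, $j=1,2$) are invariant and irreducible under the representation $M_A$ restricted to $P_B$. Denote by $M^B_{0,0}$, $M^{B,\pm}_{n,0}$ ($n\ge1$), $M^{B,\pm}_{n,j}$ ($n\ge0$, $j=1,2$) the resulting representations of $P_B$. They are pairwise inequivalent and monomial. Moreover $M^B_{0,0}$ is the trivial representation and $$M^{B,\pm}_{n,0}=\mathrm{Ind}_{\tilde P_{B,v}}^{P_B}\chi^\pm_{B,v},\quad v\in\varpi^{-n}A\setminus\varpi^{-n}B,\ n\ge1;$$ $$M^{B,\pm}_{n,2}=\mathrm{Ind}_{\tilde P_{B,v}}^{P_B}\chi^\pm_{B,v},\quad v\in\varpi^{-n}B^*\setminus\varpi^{-n}A,\ n\ge0;$$ $$M^{B,\pm}_{n,1}=\mathrm{Ind}_{\tilde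 P_{B,v}}^{P_B}\chi^\pm_{B,v},\quad v\in\varpi^{-(n+1)}B\setminus\varpi^{-n}B^*,\ n\ge0.$$ (iii) When non-zero, the same subspaces are invariant and irreducible under the restriction of the metaplectic (Weil) representation $S^A_\psi$ to $P_B$. Denote by $S^B_{0,0}$, $S^{B,\pm}_{n,0}$ ($n\ge1$), $S^{B,\pm}_{n,j}$ ($n\ge0$, $j=1,2$) the resulting representations of $P_B$. They are pairwise inequivalent, $S^B_{0,0}=\zeta$, and $$S^{B,\pm}_{n,0}=\mathrm{Ind}_{\tilde P_{B,v}}^{P_B}\zeta\chi^\pm_{B,v},\quad v\in\varpi^{-n}A\setminus\varpi^{-n}B,\ n\ge1;$$ $$S^{B,\pm}_{n,2}=\mathrm{Ind}_{\tilde P_{B,v}}^{P_B}\zeta\chi^\pm_{B,v},\quad v\in\varpi^{-n}B^*\setminus\varpi^{-n}A,\ n\ge0;$$ $$S^{B,\pm}_{n,1}=\mathrm{Ind}_{\tilde P_{B,v}}^{P_B}\zeta\chi^\pm_{B,v},\quad v\in\varpi^{-(n+1)}B\setminus\varpi^{-n}B^*,\ n\ge0.$$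
   Context: $k$ is a non-archimedean local field of characteristic $0$ with ring of integers $\mathcal{O}$, uniformizer $\varpi$, residue field $\mathbb{F}_q$ of characteristic $p\neq2$; $\psi$ is a non-trivial unitary character of $(k,+)$ with conductor $\lambda_\psi$ (trivial on $\varpi^{\lambda_\psi}\mathcal{O}$, not on $\varpi^{\lambda_\psi-1}\mathcal{O}$). $(W,\beta)$ is a symplectic $k$-space of dimension $2r>0$. A lattice is a compact open $\mathcal{O}$-submodule; $B^*=\{v\in W:\beta(v,b)\in\varpi^{\lambda_\psi}\mathcal{O}\ \forall b\in B\}$; $B$ is good if $\varpi B^*\subset B\subset B^*$, self-dual if $B=B^*$. $K_B$ is the stabilizer of $B$ in $Sp(W)$. $\dim_{\mathbb{F}_q}B^*/B=2l(B)$. $P_B=K_A\cap K_B$ is the stabilizer of $A$ in $K_B$. $\mathcal{H}^A_\psi$ is the Hilbert space of functions $\varphi:W\to\mathbb{C}$ with $\varphi(a+w)=\psi(\frac12\beta(w,a))\varphi(w)$ ($a\in A$) and $\int_{W/A}|\varphi|^2<\infty$. For $g\in P_B$, $M_A(g)\varphi(w)=\varphi(g^{-1}w)$. $\zeta$ is the character of $P_B$ with $\zeta(p)=\left(\frac{\det(p\,|\,A/B)}{q}\right)$ (determinant of $p$ on the $\mathbb{F}_q$-space $A/B$; $\left(\frac{\cdot}{q}\right)$ is the quadratic character of $\mathbb{F}_q^\times$). The maximal compact group $K_B$ is lifted to the metaplectic group $Mp(W)$, and with this lift the Weil representation $S_\psi^A$ of $Mp(W)$ on $\mathcal{H}_\psi^A$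 satisfies $S^A_\psi(p)=\zeta(p)M_A(p)$ for $p\in P_B$. $\delta_0$ is the indicator function of $A$. Subspaces of $\mathcal{H}_\psi^A$: $\mathcal{E}^B_{0,0}=\mathbb{C}\delta_0$; $\mathcal{E}^B_{n,0}=\{f:\mathrm{Supp} f\subset\varpi^{-n}A\setminus\varpi^{-n}B\}$ for $n\ge1$; $\mathcal{E}^B_{n,2}=\{f:\mathrm{Supp} f\subset\varpi^{-n}B^*\setminus\varpi^{-n}A\}$ and $\mathcal{E}^B_{n,1}=\{f:\mathrm{Supp} f\subset\varpi^{-(n+1)}B\setminus\varpi^{-n}B^*\}$ for $n\ge0$. $\mathcal{E}^+$ (resp. $\mathcal{E}^-$) denotes the subspace of even (resp. odd) functions of $\mathcal{E}$. For $v\in W\setminus A$: $P_{B,v}$ is the stabilizer in $P_B$ of $v+A\in W/A$, $\tilde P_{B,v}=\{\pm\mathrm{Id}\}P_{B,v}$ (with $-\mathrm{Id}\notin P_{B,v}$), $\chi_{B,v}(g)=\psi(\frac12\beta(gv,v))$ is a character of $P_{B,v}$, and $\chi_{B,v}^\pm$ is its extension to $\tilde P_{B,v}$ with $\chi_{B,v}^\pm(-\mathrm{Id})=\pm1$; $\zeta\chi^\pm_{B,v}$ is the product with $\zeta_{|\tilde P_{B,v}}$. Monomial means induced from a one-dimensional character; equalities of representations mean equivalence. *)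

(* Defs.v *)
From HB Require Import structures.
From mathcomp Require Import all_boot all_order all_algebra.
From mathcomp Require Import all_classical all_reals all_analysis.
From mathcomp Require Import complex.

Set Implicit Arguments.
Unset Strict Implicit.
Unset Printing Implicit Defensive.

Import Order.TTheory GRing.Theory Num.Theory.
Import numFieldNormedType.Exports.

Local Open Scope classical_set_scope.
Local Open Scope ring_scope.
Local Open Scope complex_scope.

(* [v x >= N], with the convention [v 0 = +oo]: the value of [v] at 0 is junk *)
Definition val_ge (K : zmodType) (v : K -> int) (N : int) (x : K) : Prop :=
  x = 0 \/ N <= v x.

(* Non-archimedean local fields: fields that are complete for a normalized    *)
(* discrete valuation [nav], with finite residue field [residue], and carry   *)
(* the valuation topology. [red] is the reduction map on the ring of integers *)
(* (junk outside).                                                            *)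
HB.mixin Record isNALocalField (K : Type) of GRing.Field K & Topological K := {
  nav : K -> int;
  navM : forall x y : K, x != 0 -> y != 0 -> nav (x * y) = nav x + nav y;
  navD : forall x y : K, x != 0 -> y != 0 -> x + y != 0 ->
    Num.min (nav x) (nav y) <= nav (x + y);
  nav_surj : exists x : K, x != 0 /\ nav x = 1;
  nav_nbhs : forall (x : K) (U : set K),
    nbhs x U <-> exists N : int, forall y, val_ge nav N (y - x) -> U y;
  nav_complete : forall u : nat -> K,
    (forall N : int, exists m : nat, forall i j : nat,
       (m <= i)%N -> (m <= j)%N -> val_ge nav N (u i - u j)) ->
    exists a : K, forall N : int, exists m : nat, forall i : nat,
       (m <= i)%N -> val_ge nav N (u i - a);
  residue : finFieldType;
  red : K -> residue;
  red1 : red 1 = 1;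
  redD : forall x y : K, val_ge nav 0 x -> val_ge nav 0 y ->
    red (x + y) = red x + red y;
  redM : forall x y : K, val_ge nav 0 x -> val_ge nav 0 y ->
    red (x * y) = red x * red y;
  red_surj : forall a : residue, exists2 x : K, val_ge nav 0 x & red x = a;
  red_ker : forall x : K, val_ge nav 0 x -> (red x = 0 <-> val_ge nav 1 x)
}.

#[short(type="naLocalFieldType")]
HB.structure Definition NALocalField :=
  {K of GRing.Field K & Topological K & isNALocalField K}.

Arguments residue : clear implicits.

Section LocalField.
Variable k : naLocalFieldType.

Definition integers : set k := [set x | val_ge nav 0 x].

Definition uniformizer (varpi : k) := varpi != 0 /\ nav varpi = 1.

(* varpi ^ N O *)
Definition frac_ideal (varpi : k) (N : int) : set k :=
  [set varpi ^ N * x | x in integers].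

Definition quadratic_character (R : realType) (x : residue k) : R[i] :=
  if x == 0 then 0 else if [exists y, y ^+ 2 == x] then 1 else -1.

Definition unitary_character (R : realType) (psi : k -> R[i]) :=
  [/\ forall x y, psi (x + y) = psi x * psi y,
      forall x, `|psi x| = 1 &
      continuous (psi : k -> R[i]^o)].

Definition has_conductor (R : realType) (varpi : k) (psi : k -> R[i])
    (lambda : int) :=
  (forall x, frac_ideal varpi lambda x -> psi x = 1) /\
  (exists2 x, frac_ideal varpi (lambda - 1) x & psi x <> 1).

End LocalField.

Arguments integers : clear implicits.

Section Lattices.
Variables (k : naLocalFieldType) (n : nat).
Local Notation W := 'cV[k]_n.
Implicit Types (X Y : set W) (beta : W -> W -> k).

Definition symplectic_form beta :=
  [/\ forall (a : k) u u' v, beta (a *: u + u') v = a * beta u v + beta u' v,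
      forall (a : k) u v v', beta u (a *: v + v') = a * beta u v + beta u v',
      forall u, beta u u = 0 &
      forall u, (forall v, beta u v = 0) -> u = 0].

Definition lattice X :=
  [/\ X 0,
      forall x y, X x -> X y -> X (x + y),
      forall c x, integers k c -> X x -> X (c *: x),
      compact X &
      open X].

Definition scale_set (c : k) X : set W := [set c *: x | x in X].

Definition dual_lattice beta (varpi : k) (lambda : int) X : set W :=
  [set v | forall b, X b -> frac_ideal varpi lambda (beta v b)].

Definition good_lattice beta varpi lambda X :=
  [/\ lattice X,
      scale_set varpi (dual_lattice beta varpi lambda X) `<=` X &
      X `<=` dual_lattice beta varpi lambda X].

Definition self_dual_lattice beta varpi lambda X :=
  lattice X /\ X = dual_lattice beta varpi lambda X.

(* For lattices Y <= X with varpi X <= Y: [b] induces a basis of the vector   *)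
(* space X / Y over the residue field.                                        *)
Definition quot_basis X Y (d : nat) (b : 'I_d -> W) :=
  [/\ forall i, X (b i),
      forall x, X x -> exists c : 'I_d -> k,
        (forall i, integers k (c i)) /\ Y (x - \sum_i c i *: b i) &
      forall c : 'I_d -> k, (forall i, integers k (c i)) ->
        Y (\sum_i c i *: b i) -> forall i, red (c i) = 0].

Definition quot_dim X Y (d : nat) := exists b : 'I_d -> W, quot_basis X Y b.

(* the determinant of the endomorphism of X / Y induced by [g] *)
Definition is_quot_det X Y (g : 'M[k]_n) (D : residue k) :=
  exists (d : nat) (b : 'I_d -> W) (M : 'M[k]_d),
    [/\ quot_basis X Y b,
        forall i j, integers k (M i j),
        forall j, Y (g *m b j - \sum_i M i j *: b i) &
        D = \det (map_mx (red : k -> residue k) M)].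

Definition quot_det X Y (g : 'M[k]_n) : residue k :=
  xget 0 [set D | is_quot_det X Y g D].

(* GL(W) acts on column vectors from the left *)
Definition Sp beta : set 'M[k]_n :=
  [set g | forall u v, beta (g *m u) (g *m v) = beta u v].

Definition stab beta X : set 'M[k]_n :=
  [set g | Sp beta g /\ [set g *m x | x in X] = X].

End Lattices.

Section Summation.
Variables (R : realType) (T : choiceType).
Local Notation C := R[i].

Definition real_sum (D : set T) (f : T -> R) : R :=
  fine (\esum_(x in D) (Num.max (f x) 0)%:E) -
  fine (\esum_(x in D) (Num.max (- f x) 0)%:E).

Definition complex_sum (D : set T) (f : T -> C) : C :=
  real_sum D (fun x => complex.Re (f x)) +i*
  real_sum D (fun x => complex.Im (f x)).

(* one point in each class of the equivalence relation [e] on [D] *)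
Definition transversal (x0 : T) (D : set T) (e : T -> T -> Prop) : set T :=
  [set xget x0 [set y | D y /\ e x y] | x in D].

Definition square_summable (D : set T) (f : T -> C) :=
  (\esum_(x in D) (complex.Re (`|f x| ^+ 2))%:E < +oo)%E.

Definition l2_form (D : set T) (f g : T -> C) : C :=
  complex_sum D (fun x => f x * (g x)^*).

End Summation.

Section HilbertSum.
Variables (R : realType) (X : Type).
Local Notation C := R[i].
Implicit Types (form : (X -> C) -> (X -> C) -> C) (V F : set (X -> C)).

Definition fsubspace F :=
  F (fun=> 0) /\
  forall (a : C) f g, F f -> F g -> F (fun x => a * f x + g x).

Definition nonzero_space F := exists2 f, F f & f <> (fun=> 0).

Definition dist2 form (f g : X -> C) : R :=
  complex.Re (form (fun x => f x - g x) (fun x => f x - g x)).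

Definition form_closed form V F :=
  forall f, V f ->
    (forall e : R, 0 < e -> exists2 g, F g & dist2 form f g < e) -> F f.

Definition hilbert_sum form V (I : Type) (E : I -> set (X -> C)) :=
  [/\ forall i, [/\ E i `<=` V, fsubspace (E i) & form_closed form V (E i)],
      forall i j, i <> j -> forall f g, E i f -> E j g -> form f g = 0 &
      forall f, V f -> forall e : R, 0 < e ->
        exists (s : seq I) (g : I -> X -> C),
          (forall i, E i (g i)) /\
          dist2 form f (fun x => \sum_(i <- s) g i x) < e].

End HilbertSum.

(* A representation on a space of complex functions on [rep_pt]; [rep_form]   *)
(* and [rep_act] are only relevant on [rep_space].                            *)
Record hrep (R : realType) (gT : Type) := HRep {
  rep_pt : Type;
  rep_space : set (rep_pt -> R[i]);
  rep_form : (rep_pt -> R[i]) -> (rep_pt -> R[i]) -> R[i];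
  rep_act : gT -> (rep_pt -> R[i]) -> (rep_pt -> R[i])
}.

Arguments rep_space {R gT} r _ : rename.

Section Representations.
Variables (R : realType) (gT : Type).
Local Notation C := R[i].
Local Notation hrep := (hrep R gT).
Variable G : set gT.

Definition rep_invariant (X : Type) (act : gT -> (X -> C) -> (X -> C))
    (F : set (X -> C)) :=
  forall g f, G g -> F f -> F (act g f).

Definition rep_irreducible (r : hrep) :=
  nonzero_space (rep_space r) /\
  forall F : set (rep_pt r -> C),
    F `<=` rep_space r -> fsubspace F ->
    form_closed (@rep_form _ _ r) (rep_space r) F ->
    rep_invariant (@rep_act _ _ r) F ->
    F = [set (fun=> 0)] \/ F = rep_space r.

Definition rep_equivalent (r1 r2 : hrep) :=
  exists T : (rep_pt r1 -> C) -> (rep_pt r2 -> C),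
    [/\ forall (a : C) f g, rep_space r1 f -> rep_space r1 g ->
          T (fun x => a * f x + g x) = (fun y => a * T f y + T g y),
        forall f g, rep_space r1 f -> rep_space r1 g ->
          rep_form (T f) (T g) = rep_form f g,
        [set T f | f in rep_space r1] = rep_space r2 &
        forall g f, G g -> rep_space r1 f ->
          T (rep_act g f) = rep_act g (T f)].

Definition one_dim_rep (chi : gT -> C) : hrep :=
  @HRep R gT unit setT (fun x y => x tt * (y tt)^*) (fun g x t => chi g * x t).

End Representations.

Section Induction.
Variables (R : realType) (k : naLocalFieldType) (n : nat).
Local Notation C := R[i].
Local Notation gT := 'M[k]_n.
Variable G : set gT.

Definition matrix_subgroup (H : set gT) :=
  [/\ H 1%:M,
      forall g h, H g -> H h -> H (g *m h) &
      forall g, H g -> g \in unitmx /\ H (invmx g)].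

Definition group_character (H : set gT) (chi : gT -> C) :=
  [/\ forall g h, H g -> H h -> chi (g *m h) = chi g * chi h,
      forall g, H g -> `|chi g| = 1 &
      {within H, continuous (chi : gT -> R[i]^o)}].

Definition left_cosets (H : set gT) : set gT :=
  transversal 0 G (fun x y => H (invmx x *m y)).

(* Unitary induction from an open subgroup [H] of [G], so that G / H is       *)
(* discrete: functions on [G] (extended by 0) with f(gh) = chi(h)^-1 f(g),    *)
(* square-summable on G / H, on which [G] acts by left translation.           *)
Definition Ind (H : set gT) (chi : gT -> C) : hrep R gT :=
  @HRep R gT gT
    [set f | [/\ forall g, ~ G g -> f g = 0,
                 forall g h, G g -> H h -> f (g *m h) = (chi h)^-1 * f g &
                 square_summable (left_cosets H) f]]
    (l2_form (left_cosets H))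
    (fun g f x => f (invmx g *m x)).

Definition rep_monomial (r : hrep R gT) :=
  exists (H : set gT) (chi : gT -> C),
    [/\ matrix_subgroup H,
        H `<=` G /\ (exists2 U : set gT, open U & H = G `&` U),
        group_character H chi &
        rep_equivalent G r (Ind H chi)].

End Induction.

Inductive layer_index := j0 | j1 | j2.

(* [Lpm n j s]: the even ([s = true]) or odd ([s = false]) part of E_{n,j} *)
Inductive label := L00 | Lpm of nat & layer_index & bool.

Definition valid_label (x : label) : bool :=
  match x with
  | Lpm n j0 _ => (0 < n)%N
  | _ => true
  end.

Section LatticeModel.
Variables (R : realType) (k : naLocalFieldType) (n : nat).
Local Notation C := R[i].
Local Notation W := 'cV[k]_n.
Variables (varpi : k) (lambda : int) (psi : k -> C) (beta : W -> W -> k).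
Variables (A B : set W).

Local Notation Bs := (dual_lattice beta varpi lambda B).

Definition cosets : set W := transversal 0 setT (fun x y : W => A (y - x)).

(* W / A is discrete, hence integration over it is summation, up to a factor *)
Definition Hform : (W -> C) -> (W -> C) -> C := l2_form cosets.

Definition Hspace : set (W -> C) :=
  [set phi | (forall a w, A a ->
                phi (a + w) = psi (2^-1 * beta w a) * phi w) /\
             square_summable cosets phi].

Definition M_ (g : 'M[k]_n) (phi : W -> C) : W -> C :=
  fun w => phi (invmx g *m w).

Definition P_B : set 'M[k]_n := stab beta A `&` stab beta B.

Definition zeta (g : 'M[k]_n) : C := quadratic_character R (quot_det A B g).

(* The lattice model of the Heisenberg representation, restricted to W. It is *)
(* induced from the character (a, t) |-> psi t of A x k, for the product      *)
(* (w, t) (w', t') = (w + w', t + t' + beta w w' / 2).                        *)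
Definition heisenberg (v : W) (phi : W -> C) : W -> C :=
  fun w => psi (2^-1 * beta w v) * phi (w + v).

Definition unitary_operator (U : (W -> C) -> (W -> C)) :=
  [/\ forall (a : C) f g, Hspace f -> Hspace g ->
        U (fun w => a * f w + g w) = (fun w => a * U f w + U g w),
      forall f g, Hspace f -> Hspace g -> Hform (U f) (U g) = Hform f g &
      [set U f | f in Hspace] = Hspace].

(* The metaplectic group, as the group of pairs (g, U) with U a unitary       *)
(* operator implementing g on the Heisenberg representation; the Weil         *)
(* representation is (g, U) |-> U.                                            *)
Definition metaplectic (g : 'M[k]_n) (U : (W -> C) -> (W -> C)) :=
  [/\ Sp beta g,
      unitary_operator U &
      forall v phi, Hspace phi ->
        U (heisenberg v phi) = heisenberg (g *m v) (U phi)].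

(* [S] is the Weil representation composed with a lift g |-> (g, S g) of the  *)
(* stabilizer of B to the metaplectic group, for which S = zeta M_A on P_B.   *)
Definition weil_lift (S : 'M[k]_n -> (W -> C) -> (W -> C)) :=
  [/\ forall g, stab beta B g -> metaplectic g (S g),
      forall g h phi, stab beta B g -> stab beta B h -> Hspace phi ->
        S (g *m h) phi = S g (S h phi) &
      forall p phi, P_B p -> Hspace phi ->
        S p phi = (fun w => zeta p * M_ p phi w)].

(* W is the union of A and of the [layer m j], (m, j) <> (0, 0) *)
Definition layer (m : nat) (j : layer_index) : set W :=
  match j with
  | j0 => scale_set (varpi ^- m) A `\` scale_set (varpi ^- m) B
  | j1 => scale_set (varpi ^- m.+1) B `\` scale_set (varpi ^- m) Bs
  | j2 => scale_set (varpi ^- m) Bs `\` scale_set (varpi ^- m) A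
  end.

Definition delta0 : W -> C := fun w => (w \in A)%:R.

Definition E_ (m : nat) (j : layer_index) : set (W -> C) :=
  match m, j with
  | 0%N, j0 => [set f | exists c : C, f = (fun w => c * delta0 w)]
  | _, _ => [set f | Hspace f /\ (forall w, f w != 0 -> layer m j w)]
  end.

Definition sgn (s : bool) : C := if s then 1 else -1.

Definition Epm (m : nat) (j : layer_index) (s : bool) : set (W -> C) :=
  [set f | E_ m j f /\ forall w, f (- w) = sgn s * f w].

Definition label_space (x : label) : set (W -> C) :=
  match x with
  | L00 => E_ 0 j0
  | Lpm m j s => Epm m j s
  end.

Definition subrep (act : 'M[k]_n -> (W -> C) -> (W -> C)) (x : label) :=
  @HRep R 'M[k]_n W (label_space x) Hform act.

Definition P_v (v : W) : set 'M[k]_n := [set g | P_B g /\ A (g *m v - v)].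

Definition Ptilde_v (v : W) : set 'M[k]_n :=
  [set g | P_v v g \/ P_v v (- g)].

Definition chi_v (v : W) (g : 'M[k]_n) : C := psi (2^-1 * beta (g *m v) v).

Definition chi_pm (v : W) (s : bool) (g : 'M[k]_n) : C :=
  if `[< P_v v g >] then chi_v v g else sgn s * chi_v v (- g).

End LatticeModel.

(* Main.v *)
From HB Require Import structures.
Require Import Defs.
From mathcomp Require Import all_boot all_order all_algebra.
From mathcomp Require Import all_classical all_reals all_analysis.
From mathcomp Require Import complex.
From mathcomp Require Import perm zify ring lra.

(* The chain A, B^*, varpi^-1 B, varpi^-1 A, ... exhausts W by P_B-stable     *)
(* lattices, and its successive differences, the levels, are the supports of  *)
(* the spaces E_{n,j}. Two facts about a level give everything.               *)
(*                                                                            *)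
(* Transitivity: if v, v' are in the same level, there is b in a suitable     *)
(* lattice with beta(v, b) and beta(v', b) of the same minimal valuation, and *)
(* an explicit isometry (a unipotent times a dilation, fixing the line of b)  *)
(* moves v to v' and preserves A and B.                                       *)
(*                                                                            *)
(* Separation: if v' is not in v + A nor in -v + A, choose u in A with        *)
(* beta(v - v', u) and beta(v + v', u) both outside varpi^lambda O. A         *)
(* transvection w + t beta(w, u) u then lies in P_{B,v} and P_{B,v'}, and     *)
(* chi_v / chi_v' takes on it the value psi(-t beta(v-v',u) beta(v+v',u) / 2),*)
(* which differs from 1 for some t.                                           *)
(*                                                                            *)
(* By separation, a function on which P_{B,v} acts by chi_v is supported on   *)
(* the two cosets of v and -v. Averaging over the (finite) twisted P_{B,v}-   *)
(* orbit of a function not vanishing at v thus isolates these two cosets,     *)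
(* and transitivity gives irreducibility; inequivalence follows in the same   *)
(* way. For the Weil representation, unitarity and multiplicativity on        *)
(* delta_0 show that zeta is a unitary character, so that twisting by zeta    *)
(* changes nothing in the argument.                                           *)

Set Implicit Arguments.
Unset Strict Implicit.
Unset Printing Implicit Defensive.

Import Order.TTheory GRing.Theory Num.Theory.

Local Open Scope classical_set_scope.
Local Open Scope ring_scope.

(** * Valuations and residues *)

Section Valuation.
Variable k : naLocalFieldType.
Implicit Types (x y c s : k) (M N : int).

Lemma nav1 : nav (1 : k) = 0.
Proof.
by have := @navM k 1 1 (oner_neq0 _) (oner_neq0 _); rewrite mulr1; lia.
Qed.

Lemma navN1 : nav (-1 : k) = 0.
Proof.
have n0 : (-1 : k) != 0 by rewrite oppr_eq0 oner_neq0.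
by have := navM _ _ n0 n0; rewrite mulrNN mulr1 nav1; lia.
Qed.

Lemma navV x : x != 0 -> nav x^-1 = - nav x.
Proof.
by move=> x0; have := navM _ _ x0 (invr_neq0 x0); rewrite divff // nav1; lia.
Qed.

Lemma navX x (m : nat) : x != 0 -> nav (x ^+ m) = nav x * m%:Z.
Proof.
move=> x0; elim: m => [|m IH]; first by rewrite expr0 nav1 mulr0.
by rewrite exprS navM ?expf_neq0 // IH; lia.
Qed.

Lemma navXz x N : x != 0 -> nav (x ^ N) = nav x * N.
Proof.
move=> x0; case: N => m; first exact: navX.
by rewrite NegzE -exprnN navV ?expf_neq0 // navX // mulrN.
Qed.

Definition ideal N : set k := val_ge nav N.

Lemma ideal0 N : ideal N 0. Proof. by left. Qed.

Lemma ideal_nav x : ideal (nav x) x. Proof. by right. Qed.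

Lemma idealE N x : x != 0 -> ideal N x <-> N <= nav x.
Proof. by move=> x0; split=> [[/eqP|//]|]; [rewrite (negPf x0)|right]. Qed.

Lemma not_ideal N x : ~ ideal N x -> x != 0 /\ nav x < N.
Proof.
move=> Nx; have x0 : x != 0 by apply/eqP => x0; apply: Nx; left.
by split=> //; rewrite ltNge; apply/negP => /(idealE _ x0)/Nx.
Qed.

Lemma ideal_le M N x : M <= N -> ideal N x -> ideal M x.
Proof. by move=> MN [->|Nx]; [left|right; exact: le_trans Nx]. Qed.

Lemma nav_eq N x : ideal N x -> ~ ideal (N + 1) x -> x != 0 /\ nav x = N.
Proof.
move=> Nx /not_ideal [x0 ltx]; split=> //.
by have /(idealE _ x0) := Nx; lia.
Qed.

Lemma idealD N x y : ideal N x -> ideal N y -> ideal N (x + y).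
Proof.
have [->|x0] := eqVneq x 0; first by rewrite add0r.
have [->|y0] := eqVneq y 0; first by rewrite addr0.
have [->|s0] := eqVneq (x + y) 0; first by left.
rewrite !idealE // => Nx Ny; apply: le_trans (navD _ _ x0 y0 s0).
by rewrite le_min Nx.
Qed.

Lemma idealM M N x y : ideal M x -> ideal N y -> ideal (M + N) (x * y).
Proof.
have [->|x0] := eqVneq x 0; first by rewrite mul0r; left.
have [->|y0] := eqVneq y 0; first by rewrite mulr0; left.
by rewrite !idealE ?mulf_neq0 // navM //; exact: lerD.
Qed.

Lemma ideal1 : ideal 0 1. Proof. by rewrite -nav1; exact: ideal_nav. Qed.

Lemma idealMl N x y : ideal 0 x -> ideal N y -> ideal N (x * y).
Proof. by rewrite -{2}[N]add0r; exact: idealM. Qed.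

Lemma idealN N x : ideal N x -> ideal N (- x).
Proof. by rewrite -mulN1r; apply: idealMl; right; rewrite navN1. Qed.

Lemma idealB N x y : ideal N x -> ideal N y -> ideal N (x - y).
Proof. by move=> Nx Ny; apply: idealD => //; exact: idealN. Qed.

Lemma ideal_sum (J : Type) (r : seq J) (P : pred J) (F : J -> k) N :
  (forall i, P i -> ideal N (F i)) -> ideal N (\sum_(i <- r | P i) F i).
Proof. by move=> NF; elim/big_ind: _ => //; [exact: ideal0|exact: idealD]. Qed.

Lemma ideal_prod (J : Type) (r : seq J) (F : J -> k) N :
  (forall i, ideal N (F i)) -> ideal (N * (size r)%:Z) (\prod_(i <- r) F i).
Proof.
move=> NF; elim: r => [|i r IH]; first by rewrite big_nil mulr0; exact: ideal1.
rewrite big_cons (_ : N * _ = N + N * (size r)%:Z); first exact: idealM.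
by rewrite /=; lia.
Qed.

Lemma ideal_det (n : nat) (g : 'M[k]_n) N :
  (forall i j, ideal N (g i j)) -> ideal (N * n%:Z) (\det g).
Proof.
move=> Ng; apply: ideal_sum => s _; apply: idealMl.
  by rewrite -signr_odd; case: odd; [apply: idealN|]; exact: ideal1.
have := @ideal_prod _ (enum 'I_n) (fun i => g i (s i)) N.
by rewrite size_enum_ord big_enum; apply=> i.
Qed.

Lemma idealMnav c N x : c != 0 -> ideal (nav c + N) (c * x) <-> ideal N x.
Proof.
move=> c0; split=> [|Nx]; last by apply: idealM => //; exact: ideal_nav.
rewrite -{2}(mulKf c0 x) -{2}(addKr (nav c) N) -navV //.
exact: idealM (ideal_nav _).
Qed.

Lemma ideal_div s N x : s != 0 -> ideal N (x / s) <-> ideal (nav s + N) x.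
Proof. by move=> s0; rewrite -(idealMnav _ _ s0) mulrC divfK. Qed.

Section OddResidueCharacteristic.
Hypothesis char2 : 2%N \notin [pchar (residue k)].

Lemma nav2 : (2 : k) != 0 /\ nav (2 : k) = 0.
Proof.
have O2 : ideal 0 2 by apply: idealD; exact: ideal1.
apply: (nav_eq O2) => /(red_ker _ O2).
rewrite (_ : 2 = 1 + 1) // redD ?red1; [|exact: ideal1|exact: ideal1].
move=> red2; move: char2; rewrite inE /= (_ : 2%:R = 1 + 1) // red2.
by rewrite eqxx.
Qed.

Lemma ideal_half N x : ideal N x -> ideal N (2^-1 * x).
Proof.
have [two0 two1] := nav2; apply: idealMl.
by rewrite -(oppr0 int) -two1 -navV //; exact: ideal_nav.
Qed.

End OddResidueCharacteristic.

Lemma uniformizerXz (varpi : k) N :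
  uniformizer varpi -> varpi ^ N != 0 /\ nav (varpi ^ N) = N.
Proof. by move=> [p0 p1]; rewrite expfz_neq0 // navXz // p1 mul1r. Qed.

Lemma frac_idealE (varpi : k) N : uniformizer varpi ->
  frac_ideal varpi N = ideal N.
Proof.
move=> /(uniformizerXz N) [q0 qN]; apply/seteqP; split=> [_ [x Ox <-]|x Nx].
  by have := (idealMnav 0 x q0).2 Ox; rewrite qN addr0.
by exists (x / varpi ^ N);
  [apply/ideal_div; rewrite // qN addr0|rewrite mulrC divfK].
Qed.

Lemma red0 : red (0 : k) = 0.
Proof. by apply/(red_ker _ (ideal0 0)); left. Qed.

Lemma redB x y : ideal 0 x -> ideal 0 y -> red (x - y) = red x - red y.
Proof.
move=> Ox Oy; apply/eqP; rewrite eq_sym subr_eq -redD ?subrK //.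
exact: idealB.
Qed.

Lemma red_sum (J : Type) (r : seq J) (F : J -> k) :
  (forall i, ideal 0 (F i)) ->
  red (\sum_(i <- r) F i) = \sum_(i <- r) red (F i).
Proof.
move=> OF; elim: r => [|i r IH]; first by rewrite !big_nil red0.
by rewrite !big_cons redD ?IH //; [exact: OF|apply: ideal_sum].
Qed.

End Valuation.

Section MatrixBalls.
Variable k : naLocalFieldType.
Implicit Types m n p : nat.

Definition ball_mx m n (N : int) : set 'M[k]_(m, n) :=
  [set w | forall i j, ideal N (w i j)].

Lemma ball_mx_le m n M N (w : 'M[k]_(m, n)) :
  M <= N -> ball_mx N w -> ball_mx M w.
Proof. by move=> MN Nw i j; apply: ideal_le (Nw i j). Qed.

Lemma ball_mxD m n N (v w : 'M[k]_(m, n)) :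
  ball_mx N v -> ball_mx N w -> ball_mx N (v + w).
Proof. by move=> Nv Nw i j; rewrite mxE; apply: idealD. Qed.

Lemma ball_mxB m n N (v w : 'M[k]_(m, n)) :
  ball_mx N v -> ball_mx N w -> ball_mx N (v - w).
Proof. by move=> Nv Nw i j; rewrite !mxE; apply: idealB. Qed.

Lemma ball_mxM m n p M N (v : 'M[k]_(m, n)) (w : 'M[k]_(n, p)) :
  ball_mx M v -> ball_mx N w -> ball_mx (M + N) (v *m w).
Proof.
by move=> Mv Nw i j; rewrite mxE; apply: ideal_sum => q _; apply: idealM.
Qed.

Lemma ball_mxZ m n N c (w : 'M[k]_(m, n)) :
  c != 0 -> ball_mx (nav c + N) (c *: w) <-> ball_mx N w.
Proof.
by move=> c0; split=> Nw i j; have := Nw i j; rewrite mxE idealMnav.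
Qed.

Lemma matrix_int_ub m n (f : 'I_m -> 'I_n -> int) :
  exists N, forall i j, f i j <= N.
Proof.
exists (\big[Order.max/0]_(ij : 'I_m * 'I_n) f ij.1 ij.2) => i j.
exact: (le_bigmax _ (fun ij : 'I_m * 'I_n => f ij.1 ij.2) (i, j)).
Qed.

Lemma ball_mx_exhaust m n (v : 'M[k]_(m, n)) : exists N, ball_mx N v.
Proof.
have [N leN] := matrix_int_ub (fun i j => - nav (v i j)).
by exists (- N) => i j; right; rewrite lerNl.
Qed.

Lemma nbhs_ball_mx m n (x : 'M[k]_(m, n)) (U : set 'M[k]_(m, n)) :
  nbhs x U <-> exists N, forall y, ball_mx N (y - x) -> U y.
Proof.
split=> [[P nbhsP sPU]|[N NU]].
  have /(_ _ _)/(nav_nbhs _ _)/cid NP i j := nbhsP i j.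
  have [N leN] := matrix_int_ub (fun i j => projT1 (NP i j)).
  exists N => y Ny; apply: sPU => i j; apply: (projT2 (NP i j)).
  by have := Ny i j; rewrite !mxE; apply: ideal_le.
exists (fun i j => [set z | ideal N (z - x i j)]).
  by move=> i j; apply/nav_nbhs; exists N.
by move=> y Ny; apply: NU => i j; rewrite !mxE; exact: Ny.
Qed.

Definition red_mx m n (v : 'M[k]_(m, n)) : 'M[residue k]_(m, n) := map_mx red v.

Lemma red_mxB m n (v w : 'M[k]_(m, n)) :
  ball_mx 0 v -> ball_mx 0 w -> red_mx (v - w) = red_mx v - red_mx w.
Proof. by move=> Ov Ow; apply/matrixP => i j; rewrite !mxE redB. Qed.

Lemma red_mxM m n p (v : 'M[k]_(m, n)) (w : 'M[k]_(n, p)) :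
  ball_mx 0 v -> ball_mx 0 w -> red_mx (v *m w) = red_mx v *m red_mx w.
Proof.
move=> Ov Ow; apply/matrixP => i j; rewrite !mxE red_sum.
  by apply: eq_bigr => q _; rewrite !mxE redM //; [exact: Ov|exact: Ow].
by move=> q; apply: idealMl; [exact: Ov|exact: Ow].
Qed.

Lemma red_mx_eq0 m n (v : 'M[k]_(m, n)) :
  ball_mx 0 v -> red_mx v = 0 <-> ball_mx 1 v.
Proof.
move=> Ov; split=> [/matrixP v0 i j|v1].
  by apply/(red_ker _ (Ov i j)); have := v0 i j; rewrite !mxE.
by apply/matrixP => i j; rewrite !mxE; exact/(red_ker _ (Ov i j))/v1.
Qed.

Lemma red_mx_surj m n (a : 'M[residue k]_(m, n)) :
  exists2 v : 'M[k]_(m, n), ball_mx 0 v & red_mx v = a.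
Proof.
have lift i j := cid2 (red_surj (a i j)).
exists (\matrix_(i, j) s2val (lift i j)); last first.
  by apply/matrixP => i j; rewrite !mxE (s2valP' (lift i j)).
by move=> i j; rewrite mxE; exact: (s2valP (lift i j)).
Qed.

End MatrixBalls.

(** * Lattices *)

Section Lattice.
Variables (k : naLocalFieldType) (n : nat).
Local Notation W := 'cV[k]_n.
Implicit Types (X Y : set W) (u v w : W) (g : 'M[k]_n) (c : k) (N : int).

Definition omodule X :=
  [/\ X 0, forall v w, X v -> X w -> X (v + w) &
      forall c v, ideal 0 c -> X v -> X (c *: v)].

Section OModule.
Variable X : set W.
Hypothesis modX : omodule X.

Lemma omodule0 : X 0. Proof. by have [] := modX. Qed.

Lemma omoduleD v w : X v -> X w -> X (v + w).
Proof. by have [_ XD _] := modX; exact: XD. Qed.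

Lemma omoduleZ c v : ideal 0 c -> X v -> X (c *: v).
Proof. by have [_ _ XZ] := modX; exact: XZ. Qed.

Lemma omoduleN v : X (- v) <-> X v.
Proof.
have XN w : X w -> X (- w).
  by rewrite -scaleN1r; apply: omoduleZ; apply: idealN; exact: ideal1.
by split=> /XN; rewrite ?opprK.
Qed.

Lemma omoduleB v w : X v -> X w -> X (v - w).
Proof. by move=> Xv Xw; apply: omoduleD => //; apply/omoduleN. Qed.

Lemma omoduleDl v w : X v -> X (v + w) <-> X w.
Proof.
move=> Xv; split=> [Xvw|]; last exact: omoduleD.
by rewrite -(addKr v w) addrC; exact: omoduleB.
Qed.

Lemma omodule_subC v w : X (v - w) <-> X (w - v).
Proof. by rewrite -opprB; exact: omoduleN. Qed.

Lemma omodule_sub_trans v u w : X (v - u) -> X (u - w) -> X (v - w).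
Proof. by move=> Xvu Xuw; rewrite -(subrKA u); exact: omoduleD. Qed.

Lemma omodule_sum (J : Type) (r : seq J) (P : pred J) (F : J -> W) :
  (forall i, P i -> X (F i)) -> X (\sum_(i <- r | P i) F i).
Proof.
by move=> XF; elim/big_ind: _ => //; [exact: omodule0|exact: omoduleD].
Qed.

Lemma omodule_preim_scale c : omodule [set v | X (c *: v)].
Proof.
split=> [|v w|a v Oa] /=; first by rewrite scaler0; exact: omodule0.
  by rewrite scalerDr; exact: omoduleD.
by rewrite scalerA mulrC -scalerA; exact: omoduleZ.
Qed.

End OModule.

Lemma scale_setE c X : c != 0 -> scale_set c X = [set v | X (c^-1 *: v)].
Proof.
move=> c0; apply/seteqP; split=> [_ [v Xv <-]|v Xv] /=.
  by rewrite scalerA mulVf // scale1r.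
by exists (c^-1 *: v) => //; rewrite scalerA divff // scale1r.
Qed.

(* For an O-submodule of [W], being commensurable with O^n is the same as     *)
(* being compact and open.                                                    *)
Definition olattice X :=
  [/\ omodule X, exists N, ball_mx N `<=` X & exists N, X `<=` ball_mx N].

Lemma lattice_olattice X : lattice X -> olattice X.
Proof.
move=> [X0 XD XZ /compact_near_coveringP coverX openX]; split=> //.
  move: openX; rewrite openE => /(_ 0 X0) /nbhs_ball_mx [N NX].
  by exists N => w Nw; apply: NX; rewrite subr0.
have [|N _ XN] := coverX nat \oo (fun (N : nat) x => ball_mx (- N%:Z) x) _;
  last by exists (- N%:Z) => x Xx; exact: (XN N (leqnn N) x Xx).
move=> x Xx; have [N Nx] := ball_mx_exhaust x.
exists ([set y : 'cV[k]_n | ball_mx N (y - x)], [set M | (`|N| <= M)%N]).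
  by split; [apply/nbhs_ball_mx; exists N|exists `|N|%N].
move=> [y M] /= [Ny leM]; rewrite -(subrK x y).
by apply: ball_mx_le (ball_mxD Ny Nx); lia.
Qed.

Lemma olattice_between X Y c : c != 0 -> olattice X -> omodule Y ->
  X `<=` Y -> (forall v, Y v -> X (c *: v)) -> olattice Y.
Proof.
move=> c0 [_ [M MX] [N XN]] modY XY YX.
split=> //; first by exists M => v /MX /XY.
by exists (N - nav c) => v /YX /XN Nv; apply/(ball_mxZ _ _ c0); rewrite subrKC.
Qed.

Lemma lattice_finite_cover X Y c : lattice X -> omodule Y ->
  (exists N, ball_mx N `<=` Y) -> c != 0 ->
  exists r : seq W, forall v, X (c *: v) -> exists2 w, w \in r & Y (v - w).
Proof.
move=> [_ _ _ /compact_near_coveringP coverX _] modY [N NY] c0.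
pose finer :=
  filter_from setT (fun r : seq W => [set r' : seq W | {subset r <= r'}]).
have filter_finer : Filter finer.
  apply: filter_from_filter => [|r1 r2 _ _]; first by exists [::].
  exists (r1 ++ r2) => // r rr.
  by split=> v vr; apply: rr; rewrite mem_cat vr ?orbT.
have [|r _ rP] := coverX _ _
    (fun (r : seq W) v => exists2 w, w \in r & Y (c^-1 *: v - w))
    filter_finer; last first.
  exists r => v Xv; have [w wr] := rP r (fun _ => id) _ Xv.
  by rewrite scalerA mulVf // scale1r; exists w.
move=> v Xv; exists ([set w | ball_mx (nav c + N) (w - v)],
  [set r : seq W | c^-1 *: v \in r]).
  split; first by apply/nbhs_ball_mx; exists (nav c + N).
  by exists [:: c^-1 *: v] => // r; apply; rewrite mem_head.
move=> [w r] /= [Nw vr]; exists (c^-1 *: v) => //; apply: NY.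
by rewrite -scalerBr; apply/(ball_mxZ _ _ c0); rewrite scalerA divff // scale1r.
Qed.

Lemma det_replace_col g (x : W) i : g \in unitmx ->
  \det (\matrix_(a, b) if b == i then x a 0 else g a b)
  = \det g * (invmx g *m x) i 0.
Proof.
move=> ug; rewrite /invmx ug -scalemxAl mxE mulrA divff -?unitfE // mul1r.
rewrite (expand_det_col _ i) mxE; apply: eq_bigr => a _.
rewrite !mxE eqxx mulrC; congr (_ * _); rewrite /cofactor; congr (_ * \det _).
by apply/matrixP => b c; rewrite !mxE eq_sym (negPf (neq_lift _ _)).
Qed.

Definition basis_mx X g :=
  g \in unitmx /\ forall v, X v <-> ball_mx 0 (invmx g *m v).

Lemma olattice_min_det X : olattice X ->
  exists g, [/\ g \in unitmx, forall j, X (col j g) &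
    forall g', g' \in unitmx -> (forall j, X (col j g')) ->
      nav (\det g) <= nav (\det g')].
Proof.
move=> [modX [N NX] [M XM]].
pose frame g := g \in unitmx /\ forall j, X (col j g).
have nav_frame g : frame g -> M * n%:Z <= nav (\det g).
  move=> [ug Xg]; apply/idealE; first by rewrite -unitfE.
  by apply: ideal_det => i j; have := XM _ (Xg j) i 0; rewrite mxE.
pose P d := `[< exists2 g, frame g & nav (\det g) - M * n%:Z = d%:Z >].
have exP : exists d, P d.
  have [p p_unif] := @nav_surj k; have [q0 qN] := uniformizerXz N p_unif.
  have frame_q : frame (p ^ N)%:M.
    split; first by rewrite unitmxE det_scalar unitfE expf_neq0.
    move=> j.
    apply: NX => i j'; rewrite !mxE; case: eqP => _; last exact: ideal0.
    by rewrite mulr1n -{1}qN; exact: ideal_nav.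
  exists (absz (nav (\det ((p ^ N)%:M : 'M[k]_n)) - M * n%:Z)%R).
  by apply/asboolP; exists (p ^ N)%:M => //; have := nav_frame _ frame_q; lia.
have [d /asboolP [g [ug Xg] gd] dmin] := ex_minnP exP.
exists g; split=> // g' ug' Xg'; have frame_g' : frame g' by [].
have /dmin : P (absz (nav (\det g') - M * n%:Z)%R).
  by apply/asboolP; exists g' => //; have := nav_frame _ frame_g'; lia.
by have := nav_frame _ frame_g'; lia.
Qed.

(* A frame of minimal determinant is a basis: by Cramer's rule, a vector with *)
(* a non-integral coordinate could replace a column and lower the valuation.  *)
Lemma olattice_basis X : olattice X -> exists g, basis_mx X g.
Proof.
move=> latX; have [g [ug Xg det_min]] := olattice_min_det latX.
have [modX _ _] := latX; exists g; split=> // v; split=> [Xv i j|Ov].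
  apply: contrapT; rewrite ord1 => /not_ideal [y0 yn].
  pose g' : 'M[k]_n := \matrix_(a, b) if b == i then v a 0 else g a b.
  have det_g' : \det g' = \det g * (invmx g *m v) i 0 by apply: det_replace_col.
  have d0 : \det g != 0 by rewrite -unitfE.
  have /det_min : g' \in unitmx by rewrite unitmxE det_g' unitfE mulf_neq0.
  rewrite det_g' navM // lerDl leNgt yn => /(_ _)/notF; apply=> j'.
  have [->|ne] := eqVneq j' i.
    by rewrite (_ : col _ _ = v) //; apply/colP => a; rewrite !mxE eqxx.
  rewrite (_ : col _ _ = col j' g) //; apply/colP => a.
  by rewrite !mxE (negPf ne).
rewrite -(mulKVmx ug v) -[_ *m (_ *m _)]trmxK trmx_mul mulmx_sum_row linear_sum.
apply: omodule_sum => // j _; rewrite linearZ /= tr_row trmxK mxE.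
by apply: omoduleZ => //; exact: Ov.
Qed.

End Lattice.

Section ReductionRank.
Variables (k : naLocalFieldType) (n d : nat) (M : 'M[k]_(n, d)).
Variable Y : set 'cV[k]_n.
Hypotheses (modY : omodule Y) (subY : ball_mx 1 `<=` Y)
  (Ysub : Y `<=` ball_mx 0).
Hypothesis M_int : ball_mx 0 M.
Hypothesis M_gen : forall x, ball_mx 0 x ->
  exists2 c : 'cV[k]_d, ball_mx 0 c & Y (x - M *m c).
Hypothesis M_free :
  forall c : 'cV[k]_d, ball_mx 0 c -> Y (M *m c) -> ball_mx 1 c.

Let mulM_int (c : 'cV[k]_d) : ball_mx 0 c -> ball_mx 0 (M *m c).
Proof. by move=> Oc; rewrite -[0]addr0; exact: ball_mxM. Qed.

Lemma row_free_red_mx : row_free (red_mx M)^T.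
Proof.
apply: inj_row_free => a /(congr1 trmx); rewrite trmx_mul trmxK trmx0.
have [c Oc c_a] := red_mx_surj a^T; rewrite -c_a -red_mxM // => Mc0.
apply: trmx_inj; rewrite trmx0 -c_a; apply/(red_mx_eq0 Oc)/M_free => //;
  apply: subY.
by apply/red_mx_eq0 => //; exact: mulM_int.
Qed.

Lemma row_full_red_mx : row_full (red_mx M)^T <-> Y `<=` ball_mx 1.
Proof.
split=> [full y Yy|Y1].
  have /submxP [a /(congr1 trmx)] := submx_full (red_mx y)^T full.
  have [c Oc a_c] := red_mx_surj a^T.
  rewrite trmx_mul !trmxK -a_c -red_mxM // => y_Mc.
  have Oy := Ysub Yy; apply/(red_mx_eq0 Oy); rewrite y_Mc red_mxM //.
  rewrite (red_mx_eq0 Oc).2 ?mulmx0 //; apply: M_free => //.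
  rewrite -(subrK y (M *m c)); apply: omoduleD => //; apply: subY.
  have OMc := mulM_int Oc; apply/red_mx_eq0; first exact: ball_mxB.
  by rewrite red_mxB // y_Mc subrr.
rewrite -sub1mx; apply/row_subP => i.
have [x Ox red_x] := red_mx_surj (row i (1%:M : 'M[residue k]_n))^T.
have [c Oc /Y1] := M_gen Ox; have OMc := mulM_int Oc.
have /red_mx_eq0 <- : ball_mx 0 (x - M *m c) by exact: ball_mxB.
rewrite red_mxB // red_mxM // red_x => /eqP; rewrite subr_eq0 => /eqP row_i.
by apply/submxP; exists (red_mx c)^T; apply: trmx_inj;
  rewrite row_i trmx_mul !trmxK.
Qed.

Lemma residue_basis_ltn : (d < n)%N <-> ~ (Y `<=` ball_mx 1).
Proof.
have rank_d : \rank (red_mx M)^T = d by exact/eqP/row_free_red_mx.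
have := rank_leq_col (red_mx M)^T.
rewrite -row_full_red_mx /row_full rank_d => dn.
by rewrite ltn_neqAle dn andbT; split=> /negP.
Qed.

End ReductionRank.

Lemma quot_basis_ltn (k : naLocalFieldType) (n d : nat) (X Y : set 'cV[k]_n)
    (p : k) (b : 'I_d -> 'cV[k]_n) :
  uniformizer p -> olattice X -> omodule Y ->
  scale_set p X `<=` Y -> Y `<=` X -> quot_basis X Y b ->
  (d < n)%N <-> ~ (Y `<=` scale_set p X).
Proof.
move=> [p0 p1] latX modY pXY YX [Xb b_gen b_free].
have [g [ug gX]] := olattice_basis latX; have [modX _ _] := latX.
pose M := invmx g *m \matrix_(i, j) b j i 0.
have colM j : col j M = invmx g *m b j.
  by rewrite colE -mulmxA -colE; congr (_ *m _); apply/colP => i; rewrite !mxE.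
have mulM (c : 'cV[k]_d) : g *m (M *m c) = \sum_i c i 0 *: b i.
  rewrite /M mulmxA mulKVmx //; apply/colP => i; rewrite mxE summxE.
  by apply: eq_bigr => j _; rewrite !mxE mulrC.
have pXE v : scale_set p X (g *m v) <-> ball_mx 1 v.
  rewrite scale_setE //= gX -scalemxAr mulKmx // -(ball_mxZ _ _ p0).
  by rewrite scalerA divff // scale1r p1 addr0.
have Xg v : X (g *m v) <-> ball_mx 0 v by rewrite gX mulKmx.
have -> : Y `<=` scale_set p X <-> [set v | Y (g *m v)] `<=` ball_mx 1.
  split=> YpX v Yv; first exact/pXE/YpX.
  by rewrite -(mulKVmx ug v); apply/pXE/YpX; rewrite /= mulKVmx.
apply: (residue_basis_ltn (M := M)).
- split=> [|v w|c v Oc] /=; first by rewrite mulmx0; exact: omodule0.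
    by rewrite mulmxDr; exact: omoduleD.
  by rewrite -scalemxAr; exact: omoduleZ.
- by move=> v /pXE /pXY.
- by move=> v /YX /Xg.
- by move=> i j; have := (gX _).1 (Xb j) i 0; rewrite -colM mxE.
- move=> x /Xg /b_gen [c [Oc Yc]]; exists (\col_i c i).
    by move=> i j; rewrite mxE; exact: Oc.
  rewrite /= mulmxBr mulM; congr (Y (_ - _)): Yc.
  by apply: eq_bigr => i _; rewrite mxE.
- move=> c Oc; rewrite /= mulM => /b_free red_c i j.
  by rewrite ord1; apply/(red_ker _ (Oc i 0))/red_c => i'; exact: Oc.
Qed.

(** * Transversals, matrix groups and induced representations *)

Section Transversal.
Variables (T : choiceType) (x0 : T) (D : set T) (e : T -> T -> Prop).
Hypothesis e_refl : forall x, D x -> e x x.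
Hypothesis e_sym : forall x y, D x -> D y -> e x y -> e y x.
Hypothesis e_trans : forall x y z, D x -> D y -> D z -> e x y -> e y z -> e x z.

Let repr x := xget x0 [set y | D y /\ e x y].

Let reprP x : D x -> D (repr x) /\ e x (repr x).
Proof.
move=> Dx; apply: (@xgetPex _ x0 [set y | D y /\ e x y]).
by exists x; split=> //; exact: e_refl.
Qed.

Lemma transversal_sub : Defs.transversal x0 D e `<=` D.
Proof. by move=> _ [x Dx <-]; have [] := reprP Dx. Qed.

Lemma transversal_ex x : D x -> exists2 t, Defs.transversal x0 D e t & e x t.
Proof. by move=> Dx; exists (repr x); [exists x|have [] := reprP Dx]. Qed.

Lemma transversal_inj t t' : Defs.transversal x0 D e t ->
  Defs.transversal x0 D e t' -> e t t' -> t = t'.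
Proof.
move=> [x Dx <-] [x' Dx' <-]; rewrite -/(repr x) -/(repr x') => rr'.
have [Dr xr] := reprP Dx; have [Dr' xr'] := reprP Dx'.
have xx' : e x x'.
  by apply: e_trans (xr) _ => //; apply: e_trans rr' _ => //; exact: e_sym.
congr (xget x0 _); apply/seteqP; split=> y [Dy ey]; split=> //.
  by apply: e_trans ey => //; exact: e_sym.
exact: e_trans ey.
Qed.

End Transversal.

Section MatrixGroups.
Variables (k : naLocalFieldType) (n : nat).
Local Notation gT := 'M[k]_n.
Implicit Types (G H K : set gT) (g h x y : gT).

Lemma invmxM g h : g \in unitmx -> h \in unitmx ->
  invmx (g *m h) = invmx h *m invmx g.
Proof.
move=> ug uh; have u : g *m h \in unitmx by rewrite unitmx_mul ug.
by rewrite -[RHS](mulmxK u) mulmxA mulmxKV // mulVmx // mul1mx.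
Qed.

Lemma unitmxN g : (- g \in unitmx) = (g \in unitmx).
Proof. by rewrite -scaleN1r unitmxZ ?unitrN1. Qed.

Lemma invmxN g : invmx (- g) = - invmx g.
Proof.
have [ug|nug] := boolP (g \in unitmx);
  last by rewrite !invmx_out // inE /= unitmxN.
by rewrite -{1}scaleN1r invmxZ ?scaleN1r ?unitmxN // invrN1 scaleN1r.
Qed.

Lemma matrix_subgroupI H K :
  matrix_subgroup H -> matrix_subgroup K -> matrix_subgroup (H `&` K).
Proof.
move=> [H1 HM HV] [K1 KM KV]; split=> // [g h [Hg Kg] [Hh Kh]|g [Hg Kg]].
  by split; [exact: HM|exact: KM].
by have [ug HgV] := HV g Hg; have [_ KgV] := KV g Kg.
Qed.

Lemma matrix_subgroup_pm H :
  matrix_subgroup H -> matrix_subgroup [set g | H g \/ H (- g)].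
Proof.
move=> [H1 HM HV]; split=> [|g h|g].
- by left.
- by move=> [Hg|Hg] [Hh|Hh]; [left|right|right|left]; have := HM _ _ Hg Hh;
    rewrite ?mulNmx ?mulmxN ?opprK.
- move=> [/HV [ug HgV]|/HV [ug HgV]]; first by split=> //; left.
  split; last by right; rewrite -invmxN.
  by rewrite -unitmxN.
Qed.

Section LeftCosets.
Variables G H : set gT.
Hypotheses (groupG : matrix_subgroup G) (groupH : matrix_subgroup H).

Let same_coset x y := H (invmx x *m y).

Let same_coset_refl x : G x -> same_coset x x.
Proof.
have [H1 _ _] := groupH; have [_ _ GV] := groupG.
by move=> /GV [ux _]; rewrite /same_coset mulVmx.
Qed.

Let same_coset_sym x y : G x -> G y -> same_coset x y -> same_coset y x.
Proof.
have [_ _ HV] := groupH; have [_ _ GV] := groupG.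
move=> /GV [ux _] /GV [uy _] /HV [_].
by rewrite invmxM ?unitmx_inv // invmxK.
Qed.

Let same_coset_trans x y z : G x -> G y -> G z ->
  same_coset x y -> same_coset y z -> same_coset x z.
Proof.
have [_ HM _] := groupH; have [_ _ GV] := groupG.
move=> Gx /GV [uy _] Gz xy yz; have := HM _ _ xy yz.
by rewrite -mulmxA (mulmxA y) mulmxV // mul1mx.
Qed.

Lemma left_cosets_sub : left_cosets G H `<=` G.
Proof. exact: transversal_sub same_coset_refl. Qed.

Lemma left_cosets_ex x : G x -> exists2 t, left_cosets G H t & H (invmx t *m x).
Proof.
move=> Gx; have [t tL xt] := transversal_ex 0 same_coset_refl Gx.
by exists t => //; apply: same_coset_sym => //; exact: left_cosets_sub.
Qed.

Lemma left_cosets_inj t t' : left_cosets G H t -> left_cosets G H t' ->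
  H (invmx t *m t') -> t = t'.
Proof.
exact: transversal_inj same_coset_refl same_coset_sym same_coset_trans _ _.
Qed.

Lemma Ind_ext (R : realType) (chi : gT -> R[i]) f f' :
  rep_space (Ind G H chi) f -> rep_space (Ind G H chi) f' ->
  (forall t, left_cosets G H t -> f t = f' t) -> f = f'.
Proof.
move=> [f0 fH _] [f'0 f'H _] ff'; apply/funext => x.
have [Gx|nGx] := pselect (G x); last by rewrite f0 ?f'0.
have [t tL tx] := left_cosets_ex Gx; have Gt := left_cosets_sub tL.
have [_ _ /(_ t Gt) [ut _]] := groupG.
by rewrite -(mulKVmx ut x) fH // f'H // ff'.
Qed.

End LeftCosets.
End MatrixGroups.

Lemma rep_equivalent_trans (R : realType) (gT : Type) (G : set gT)
    (r1 r2 r3 : hrep R gT) :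
  rep_equivalent G r1 r2 -> rep_equivalent G r2 r3 -> rep_equivalent G r1 r3.
Proof.
move=> [T [Tlin Tiso Tim Tact]] [U [Ulin Uiso Uim Uact]].
have T2 f : rep_space r1 f -> rep_space r2 (T f).
  by move=> Vf; rewrite -Tim; exists f.
exists (U \o T); split=> /=.
- by move=> a f g Vf Vg; rewrite Tlin // Ulin //; exact: T2.
- by move=> f g Vf Vg; rewrite Uiso ?Tiso //; exact: T2.
- by rewrite -Uim -Tim -image_comp.
- by move=> g f Gg Vf; rewrite Tact // Uact //; exact: T2.
Qed.

(** * Square-summable functions *)

Section ComplexSums.
Variables (R : realType) (T : choiceType).
Local Notation C := R[i].
Implicit Types (D : set T) (r : seq T) (f g : T -> C) (z : C).

Definition sqnorm z : R := complex.Re (`|z| ^+ 2).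

Lemma sqnormE z : sqnorm z = complex.Re z ^+ 2 + complex.Im z ^+ 2.
Proof. by rewrite /sqnorm -add_Re2_Im2. Qed.

Lemma sqnorm_ge0 z : 0 <= sqnorm z.
Proof. by rewrite sqnormE addr_ge0 // sqr_ge0. Qed.

Lemma mul_conjC_sqnorm z : z * z^* = (sqnorm z)%:C%C.
Proof. by rewrite -normCK -add_Re2_Im2 sqnormE. Qed.

Lemma sqnorm_eq0 z : (sqnorm z == 0) = (z == 0).
Proof.
by rewrite -[z == 0]orbb -{2}conjC_eq0 -mulf_eq0 mul_conjC_sqnorm eq_complex /=
  eqxx andbT.
Qed.

Lemma sqnorm_gt0 z : (0 < sqnorm z) = (z != 0).
Proof. by rewrite lt_neqAle sqnorm_ge0 andbT eq_sym sqnorm_eq0. Qed.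

Lemma sqnorm0 : sqnorm 0 = 0. Proof. by apply/eqP; rewrite sqnorm_eq0. Qed.

Lemma esum_seq D r (a : T -> R) : uniq r -> (forall x, x \in r -> D x) ->
  (forall x, 0 <= a x) -> (forall x, D x -> a x != 0 -> x \in r) ->
  (\esum_(x in D) (a x)%:E = (\sum_(x <- r) a x)%:E)%E.
Proof.
move=> ur rD a0 supp.
have -> : (\esum_(x in D) (a x)%:E = \esum_(x in [set` r]) (a x)%:E)%E.
  rewrite [LHS]esum_mkcond [RHS]esum_mkcond; apply: eq_esum => x _.
  case: (boolP (x \in r)) => xr; first by rewrite !mem_set //; exact: rD.
  rewrite [x \in [set` r]]memNset; last exact/negP.
  case: ifPn => //; rewrite inE => Dx; congr EFin.
  by apply/eqP; apply: contraNT xr => /(supp _ Dx).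
rewrite esum_fset //; last by move=> x _; rewrite lee_fin.
by rewrite fsumEFin // -fsbig_seq.
Qed.

Lemma real_sum_seq D r (a : T -> R) : uniq r -> (forall x, x \in r -> D x) ->
  (forall x, D x -> a x != 0 -> x \in r) -> real_sum D a = \sum_(x <- r) a x.
Proof.
move=> ur rD supp.
have part (b : T -> R) : (forall x, a x = 0 -> b x = 0) ->
    fine (\esum_(x in D) (Num.max (b x) 0)%:E) = \sum_(x <- r) Num.max (b x) 0.
  move=> b0; rewrite (esum_seq ur rD) // => [x|x Dx].
    by rewrite le_max lexx orbT.
  by move=> bx; apply: supp => //; apply: contraNneq bx => /b0 ->;
    rewrite maxxx.
rewrite /real_sum !part // => [|x ->]; last by rewrite oppr0.
rewrite -sumrB; apply: eq_bigr => x _; rewrite !maxEle oppr_le0.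
by case: (leP (a x) 0) => ?; case: leP => ?; lra.
Qed.

Lemma complex_sum_seq D r f : uniq r -> (forall x, x \in r -> D x) ->
  (forall x, D x -> f x != 0 -> x \in r) -> complex_sum D f = \sum_(x <- r) f x.
Proof.
move=> ur rD supp; rewrite /complex_sum !(real_sum_seq ur rD).
- elim: r {ur rD supp} => [|x r IH]; first by rewrite !big_nil.
  rewrite !big_cons -IH; apply/eqP; rewrite eq_complex /=.
  by case: (f x) => a b /=; rewrite !eqxx.
- by move=> x Dx fx; apply: supp => //; apply: contraNneq fx => ->.
- by move=> x Dx fx; apply: supp => //; apply: contraNneq fx => ->.
Qed.

Lemma l2_form_disjoint D f g : (forall x, D x -> f x = 0 \/ g x = 0) ->
  l2_form D f g = 0.
Proof.
move=> fg0; rewrite /l2_form (@complex_sum_seq _ [::]) ?big_nil // => x Dx.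
by case: (fg0 x Dx) => ->; rewrite ?conjC0 ?mulr0 ?mul0r eqxx.
Qed.

Definition sqnorm_sum D f : \bar R := (\esum_(x in D) (sqnorm (f x))%:E)%E.

Lemma sqnorm_sum_ge0 D f : (0 <= sqnorm_sum D f)%E.
Proof. by apply: esum_ge0 => x _; rewrite lee_fin sqnorm_ge0. Qed.

Lemma sqnorm_sum_fin_num D f :
  square_summable D f <-> sqnorm_sum D f \is a fin_num.
Proof. by rewrite ge0_fin_numE ?sqnorm_sum_ge0. Qed.

Lemma square_summable_seq D r f : (forall x, D x -> f x != 0 -> x \in r) ->
  square_summable D f.
Proof.
move=> supp; pose r' := [seq x <- undup r | `[< D x >]].
rewrite /square_summable (@esum_seq _ r') ?ltry //.
- by rewrite filter_uniq // undup_uniq.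
- by move=> x; rewrite mem_filter => /andP [/asboolP].
- by move=> x; exact: sqnorm_ge0.
- move=> x Dx; rewrite sqnorm_eq0 => fx.
  by rewrite mem_filter mem_undup supp // andbT; exact/asboolP.
Qed.

Lemma l2_form_diag D f : l2_form D f f = (fine (sqnorm_sum D f))%:C%C.
Proof.
rewrite /l2_form /complex_sum; congr (_ +i* _)%C; rewrite /real_sum.
  under eq_esum do rewrite mul_conjC_sqnorm /= max_l ?sqnorm_ge0 //.
  rewrite -/(sqnorm_sum D f) [X in _ - fine X]esum1 ?subr0 // => x _.
  by rewrite mul_conjC_sqnorm /= max_r // oppr_le0 sqnorm_ge0.
by rewrite !esum1 ?subr0 // => x _; rewrite mul_conjC_sqnorm /= ?oppr0 maxxx.
Qed.

Lemma dist2_l2 D f g :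
  dist2 (l2_form D) f g = fine (sqnorm_sum D (fun x => f x - g x)).
Proof. by rewrite /dist2 (l2_form_diag D (fun x => f x - g x)). Qed.

Lemma sqnorm_le_sum D f x : square_summable D f -> D x ->
  sqnorm (f x) <= fine (sqnorm_sum D f).
Proof.
move=> /sqnorm_sum_fin_num finf Dx; rewrite -lee_fin fineK //.
by apply: esum_ge; exists [set x]; [split=> // _ ->|rewrite fsbig_set1].
Qed.

Lemma l2_form_neq0 D f x : square_summable D f -> D x -> f x != 0 ->
  l2_form D f f != 0.
Proof.
move=> sumf Dx fx; rewrite l2_form_diag eq_complex /= eqxx andbT gt_eqF //.
by apply: lt_le_trans (sqnorm_le_sum sumf Dx); rewrite sqnorm_gt0.
Qed.

Lemma esumZ_lty D (a : R) (u : T -> R) : 0 <= a -> (forall x, 0 <= u x) ->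
  (\esum_(x in D) (u x)%:E < +oo -> \esum_(x in D) (a * u x)%:E < +oo)%E.
Proof.
move=> a0 u0 sumu; apply: (@le_lt_trans _ _ (a%:E * \esum_(x in D) (u x)%:E)%E).
  apply: ge_ereal_sup => _ [X [finX XD] <-].
  under eq_fsbigr do rewrite EFinM.
  rewrite -ge0_mule_fsumr; last by move=> x; rewrite lee_fin.
  by apply: lee_wpmul2l; [rewrite lee_fin|apply: ereal_sup_ubound; exists X].
by apply: lte_mul_pinfty => //; rewrite lee_fin.
Qed.

Lemma square_summableD D f g (a : C) :
  square_summable D f -> square_summable D g ->
  square_summable D (fun x => a * f x + g x).
Proof.
move=> sumf sumg; pose c := 2 * sqnorm a.
have sqnorm_lin x :
    sqnorm (a * f x + g x) <= c * sqnorm (f x) + 2 * sqnorm (g x).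
  rewrite {}/c !sqnormE; case: a (f x) (g x) => a1 a2 [f1 f2] [g1 g2] /=.
  have := sqr_ge0 (a1 * f1 - a2 * f2 - g1).
  by have := sqr_ge0 (a1 * f2 + a2 * f1 - g2); nra.
have c0 : 0 <= c by rewrite mulr_ge0 // sqnorm_ge0.
apply: (@le_lt_trans _ _ (\esum_(x in D) (c * sqnorm (f x))%:E
    + \esum_(x in D) (2 * sqnorm (g x))%:E)%E); last first.
  by apply: lte_add_pinfty; apply: esumZ_lty => // x; exact: sqnorm_ge0.
rewrite -esumD; try by move=> x _; rewrite lee_fin mulr_ge0 // sqnorm_ge0.
by apply: le_esum => x _; rewrite -EFinD lee_fin; exact: sqnorm_lin.
Qed.

Lemma sqnorm_le_dist2 D f g x :
  square_summable D f -> square_summable D g -> D x ->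
  sqnorm (f x - g x) <= dist2 (l2_form D) f g.
Proof.
move=> sumf sumg Dx; rewrite dist2_l2.
apply: (sqnorm_le_sum (f := fun y => f y - g y)) => //.
have := square_summableD (-1) sumg sumf; congr (square_summable D).
by apply/funext => y; rewrite mulN1r addrC.
Qed.

Lemma square_summable_tail D f (e : R) : square_summable D f -> 0 < e ->
  exists2 r : seq T, (forall x, x \in r -> D x) &
    forall E, (forall x, x \in r -> E x) ->
      fine (sqnorm_sum (D `&` ~` E) f) < e.
Proof.
move=> sumf e0.
have sq0 x : (0 <= (sqnorm (f x))%:E)%E by rewrite lee_fin sqnorm_ge0.
have [_ [X [finX XD] <-]] : exists2 y,
    [set \sum_(x \in X) (sqnorm (f x))%:E | X in fsets D]%E y
    & (sqnorm_sum D f - e%:E < y)%E.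
  apply: ereal_sup_gt; rewrite -/(esum _ _) lteBlDr ?lteDl ?lte_fin //.
  exact/sqnorm_sum_fin_num.
have /finite_seqP [r X_r] := finX; rewrite X_r in XD *.
move=> ltX; exists r => // E rE.
have leE :
  (\sum_(x \in [set` r]) (sqnorm (f x))%:E <= sqnorm_sum (D `&` E) f)%E.
  apply: esum_ge; exists [set` r] => //; split; first exact: finite_seq.
  by move=> x xr; split; [exact: XD|exact: rE].
have fin_sub E' : sqnorm_sum (D `&` E') f \is a fin_num.
  apply/sqnorm_sum_fin_num; apply: le_lt_trans sumf; rewrite esum_mkcondr.
  by apply: le_esum => x _; case: ifP => _; [exact: lexx|exact: sq0].
have := lt_le_trans ltX leE;
  rewrite /sqnorm_sum (@esumID _ _ E) // -!/(sqnorm_sum _ f).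
rewrite -(fineK (fin_sub E)) -(fineK (fin_sub (~` E))) -EFinN -!EFinD lte_fin;
  lra.
Qed.

Lemma dist2_fibres D f (level_of : T -> nat) (e : R) :
  square_summable D f -> 0 < e -> exists2 s : seq nat, uniq s &
    dist2 (l2_form D) f (fun x => if level_of x \in s then f x else 0) < e.
Proof.
move=> sumf e0; have [r _ tail] := square_summable_tail sumf e0.
pose s := undup [seq level_of x | x <- r]; exists s; first exact: undup_uniq.
have : fine (sqnorm_sum (D `&` ~` [set x | level_of x \in s]) f) < e.
  by apply: tail => x xr; rewrite /= mem_undup; exact: map_f.
rewrite dist2_l2 {1}/sqnorm_sum esum_mkcondr; congr (fine _ < e).
apply: eq_esum => x _; case: ifPn => xs.
  by rewrite ifN ?subr0 //; move: xs; rewrite inE => /negP.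
by move: xs; rewrite notin_setE => /contrapT ->; rewrite subrr sqnorm0.
Qed.

End ComplexSums.

Section FunctionSubspaces.
Variables (R : realType) (X : Type) (F : set (X -> R[i])).
Hypothesis subF : fsubspace F.

Lemma fsubspaceZ (a : R[i]) f : F f -> F (fun x => a * f x).
Proof.
have [F0 FD] := subF; move=> Ff; have := FD a _ _ Ff F0.
by congr F; apply/funext => x; rewrite addr0.
Qed.

Lemma fsubspace_sum (J : eqType) (r : seq J) (f : J -> X -> R[i]) :
  (forall j, j \in r -> F (f j)) -> F (fun x => \sum_(j <- r) f j x).
Proof.
have [F0 FD] := subF; elim: r => [|j r IH] Ff.
  by have := F0; congr F; apply/funext => x; rewrite big_nil.
have Fr : F (fun x => \sum_(j <- r) f j x).
  by apply: IH => i ir; apply: Ff; rewrite inE ir orbT.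
have := FD 1 _ _ (Ff j (mem_head _ _)) Fr; congr F.
by apply/funext => x; rewrite big_cons mul1r.
Qed.

End FunctionSubspaces.

Section OneDimensional.
Variables (R : realType) (k : naLocalFieldType) (n : nat).
Variables (G : set 'M[k]_n) (chi : 'M[k]_n -> R[i]).
Hypotheses (groupG : matrix_subgroup G) (charG : group_character G chi).

Lemma one_dim_rep_Ind : rep_equivalent G (one_dim_rep chi) (Ind G G chi).
Proof.
have [chiM chi_norm _] := charG; have [G1 GM GV] := groupG.
have chi0 g : G g -> chi g != 0.
  by move=> Gg; rewrite -normr_eq0 chi_norm ?oner_neq0.
have [t tL _] := left_cosets_ex groupG groupG G1.
have Gt : G t by exact: (left_cosets_sub groupG groupG tL).
have t_unique x : left_cosets G G x -> x = t.
  move=> xL; apply: (left_cosets_inj groupG groupG xL tL); apply: GM => //.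
  by have [_] := GV x (left_cosets_sub groupG groupG xL).
pose emb (f : unit -> R[i]) x := if `[< G x >] then (chi x)^-1 * f tt else 0.
have emb_in f : rep_space (Ind G G chi) (emb f).
  split=> [g nGg|g h Gg Gh|]; rewrite /emb; first by rewrite asboolF.
    by rewrite !asboolT //; [rewrite chiM // invfM; ring|exact: GM].
  by apply: (@square_summable_seq _ _ _ [:: t]) => x /t_unique -> _;
    rewrite mem_head.
exists emb; split=> [a f g _ _|f g _ _||g f Gg _] /=.
- by apply/funext => x; rewrite /emb; case: asboolP => _;
    [ring|rewrite mulr0 addr0].
- rewrite /l2_form (@complex_sum_seq _ _ _ [:: t]) //; last 2 first.
  + by move=> x; rewrite inE => /eqP ->.
  + by move=> x /t_unique -> _; rewrite mem_head.
  rewrite big_seq1 /emb asboolT // rmorphM mulrACA -normCK normfV chi_norm //.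
  by rewrite invr1 expr1n mul1r.
- apply/seteqP; split=> [_ [f _ <-]|Phi Ind_Phi]; first exact: emb_in.
  exists (fun=> chi t * Phi t) => //.
  apply: (Ind_ext groupG groupG (emb_in _) Ind_Phi) => x /t_unique ->.
  by rewrite /emb asboolT // mulKf // chi0.
- apply/funext => x; rewrite /emb; have [ug GgV] := GV g Gg.
  have [Gx|nGx] := pselect (G x); last first.
    rewrite !asboolF // => Ggx; apply: nGx.
    by rewrite -(mulKVmx ug x); exact: GM.
  have Ggx : G (invmx g *m x) by exact: GM.
  rewrite !asboolT // -{1}(mulKVmx ug x) chiM // invfM mulrA; congr (_ * _).
  by rewrite mulrAC mulVf ?chi0 // mul1r.
Qed.

Lemma one_dim_monomial (r : hrep R 'M[k]_n) :
  rep_equivalent G r (one_dim_rep chi) -> rep_monomial G r.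
Proof.
move=> r_chi; exists G, chi; split=> //.
  by split=> //; exists setT; [exact: openT|rewrite setIT].
exact: rep_equivalent_trans r_chi one_dim_rep_Ind.
Qed.

End OneDimensional.

Section LatticeModel.
Variables (k : naLocalFieldType) (n : nat).
Local Notation W := 'cV[k]_n.
Variable beta : W -> W -> k.
Hypothesis beta_sympl : symplectic_form beta.
Implicit Types (u v w b : W) (g h : 'M[k]_n) (c : k) (L X Y Z : set W).

(** * Symplectic maps *)

Let bilinear_beta : bilinear_for *%R *%R beta.
Proof. by have [betaPl betaPr _ _] := beta_sympl; split=> w c u v. Qed.

Let beta_form : {bilinear W -> W -> k | *%R & *%R} :=
  HB.pack beta (bilinear_isBilinear.Build k W W k *%R *%R beta bilinear_beta).

Lemma betavv u : beta u u = 0. Proof. by have [_ _ + _] := beta_sympl. Qed.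

Lemma betaDl u v w : beta (u + v) w = beta u w + beta v w.
Proof. exact: (linearDl beta_form). Qed.

Lemma betaDr u v w : beta u (v + w) = beta u v + beta u w.
Proof. exact: (linearDr beta_form). Qed.

Lemma betaNl u v : beta (- u) v = - beta u v.
Proof. exact: (linearNl beta_form). Qed.

Lemma betaNr u v : beta u (- v) = - beta u v.
Proof. exact: (linearNr beta_form). Qed.

Lemma betaZl c u v : beta (c *: u) v = c * beta u v.
Proof. exact: (linearZl_LR beta_form). Qed.

Lemma betaZr c u v : beta u (c *: v) = c * beta u v.
Proof. exact: (linearZr_LR beta_form). Qed.

Lemma beta0l v : beta 0 v = 0. Proof. exact: (linear0l beta_form). Qed.

Lemma beta0r v : beta v 0 = 0. Proof. exact: (linear0r beta_form). Qed.

Lemma beta_suml (J : Type) (r : seq J) (F : J -> W) w :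
  beta (\sum_(i <- r) F i) w = \sum_(i <- r) beta (F i) w.
Proof. exact: (linear_sumlz beta_form). Qed.

Lemma beta_sumr (J : Type) (r : seq J) (F : J -> W) w :
  beta w (\sum_(i <- r) F i) = \sum_(i <- r) beta w (F i).
Proof. exact: (linear_sumr beta_form). Qed.

Definition betaE :=
  (betaDl, betaDr, betaNl, betaNr, betaZl, betaZr, betavv, beta0l, beta0r).

Lemma betaC u v : beta u v = - beta v u.
Proof.
by apply/eqP; rewrite -addr_eq0; have := betavv (u + v);
  rewrite !betaE add0r addr0 => ->.
Qed.

Lemma cV_sum_delta w : w = \sum_i w i 0 *: delta_mx i 0.
Proof.
by rewrite {1}(matrix_sum_delta w); apply: eq_bigr => i _; rewrite big_ord1.
Qed.

Definition gram_mx : 'M[k]_n :=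
  \matrix_(i, j) beta (delta_mx i 0) (delta_mx j 0).

Lemma beta_gram_mx v w : beta v w = (v^T *m gram_mx *m w) 0 0.
Proof.
rewrite {1}(cV_sum_delta w) beta_sumr mxE; apply: eq_bigr => j _.
rewrite betaZr mulrC; congr (_ * _).
rewrite {1}(cV_sum_delta v) beta_suml mxE; apply: eq_bigr => i _.
by rewrite betaZl !mxE.
Qed.

Lemma gram_mx_unit : gram_mx \in unitmx.
Proof.
have [_ _ _ nondeg] := beta_sympl; rewrite -row_free_unit.
apply: inj_row_free => a aJ; apply: trmx_inj; rewrite trmx0; apply: nondeg => w.
by rewrite beta_gram_mx trmxK aJ mul0mx mxE.
Qed.

Lemma beta_represents (a : 'rV[k]_n) :
  exists u, forall w, beta w u = (a *m w) 0 0.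
Proof.
exists (invmx gram_mx *m a^T) => w.
rewrite beta_gram_mx -mulmxA mulKVmx ?gram_mx_unit //.
by rewrite -[a *m w]trmxK trmx_mul [RHS]mxE.
Qed.

Lemma Sp_unit g : Sp beta g -> g \in unitmx.
Proof.
have [_ _ _ nondeg] := beta_sympl => Sp_g; rewrite -unitmx_tr -row_free_unit.
apply: inj_row_free => a ga; apply: trmx_inj; rewrite trmx0; apply: nondeg => w.
by rewrite -Sp_g -[g in g *m a^T]trmxK -trmx_mul ga trmx0 beta0l.
Qed.

Definition mx_of_fun (f : W -> W) : 'M[k]_n :=
  \matrix_(i, j) f (delta_mx j 0) i 0.

Lemma mul_mx_of_fun f w : linear f -> mx_of_fun f *m w = f w.
Proof.
move=> lin_f.
pose F : {linear W -> W} := HB.pack f (GRing.isLinear.Build k W W *:%R f lin_f).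
rewrite {2}(cV_sum_delta w) -[f]/(F : W -> W) linear_sum; apply/colP => i.
by rewrite mxE summxE; apply: eq_bigr => j _; rewrite linearZ /= !mxE mulrC.
Qed.

(* The isometry moving [v] to [v'] in the parabolic subgroup that fixes the   *)
(* line of [b].                                                               *)
Definition shear v v' b w : W :=
  w + (beta w b / beta v b) *: (v' - v)
    + (beta w (v' - v) / beta v' b
       - beta w b / beta v b * (beta v v' / beta v' b)) *: b.

Section Shear.
Variables v v' b : W.
Hypotheses (vb : beta v b != 0) (v'b : beta v' b != 0).

Lemma shear_linear : linear (shear v v' b).
Proof.
by move=> c u w; rewrite /shear !betaE; apply/colP => i; rewrite !mxE; ring.
Qed.

Lemma shear_moves : shear v v' b v = v'.
Proof.
by rewrite /shear !betaE; apply/colP => i; rewrite !mxE; field; rewrite vb v'b.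
Qed.

Lemma shear_isometry u w : beta (shear v v' b u) (shear v v' b w) = beta u w.
Proof.
rewrite /shear !betaE.
rewrite (betaC b w) (betaC b v) (betaC b v') (betaC v' v) (betaC v w)
  (betaC v' w).
by field; rewrite vb v'b.
Qed.

Lemma shearK : cancel (shear v v' b) (shear v' v b).
Proof.
move=> w; rewrite /shear !betaE (betaC b v) (betaC b v') (betaC v' v).
by apply/colP => i; rewrite !mxE; field; rewrite vb v'b.
Qed.

End Shear.

Definition transvection t u w : W := w + (t * beta w u) *: u.

Lemma transvection_linear t u : linear (transvection t u).
Proof.
by move=> c v w; rewrite /transvection !betaE; apply/colP => i; rewrite !mxE;
  ring.
Qed.

Lemma transvection_isometry t u v w :
  beta (transvection t u v) (transvection t u w) = beta v w.
Proof. by rewrite /transvection !betaE (betaC u w); ring. Qed.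

Lemma transvectionK t u : cancel (transvection (- t) u) (transvection t u).
Proof.
by move=> w; rewrite /transvection !betaE; apply/colP => i; rewrite !mxE; ring.
Qed.

(** * Dual lattices *)

Variables (varpi : k) (lambda : int).
Hypothesis varpi_unif : uniformizer varpi.
Local Notation dual := (dual_lattice beta varpi lambda).

Lemma varpi_neq0 : varpi != 0. Proof. by have [] := varpi_unif. Qed.

Lemma nav_varpi : nav varpi = 1. Proof. by have [] := varpi_unif. Qed.

Lemma varpiX_neq0 m : varpi ^+ m != 0.
Proof. by rewrite expf_neq0 // varpi_neq0. Qed.

Lemma nav_varpiX m : nav (varpi ^+ m) = m%:Z.
Proof. by rewrite navX ?varpi_neq0 // nav_varpi mul1r. Qed.

Lemma ideal_varpiM N c : ideal (1 + N) (varpi * c) <-> ideal N c.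
Proof. by rewrite -nav_varpi; exact: idealMnav varpi_neq0. Qed.

Lemma dualP X v : dual X v <-> forall b, X b -> ideal lambda (beta v b).
Proof. by rewrite /dual_lattice /= frac_idealE. Qed.

Lemma dual_omodule X : omodule (dual X).
Proof.
split=> [|u v /dualP Xu /dualP Xv|c v Oc /dualP Xv]; apply/dualP => b Xb;
  rewrite betaE.
- exact: ideal0.
- by apply: idealD; [exact: Xu|exact: Xv].
- by apply: idealMl => //; exact: Xv.
Qed.

Lemma dual_sub X Y : X `<=` Y -> dual Y `<=` dual X.
Proof. by move=> XY v /dualP Yv; apply/dualP => b /XY; exact: Yv. Qed.

Lemma dual_witness X v :
  ~ dual X v -> exists2 b, X b & ~ ideal lambda (beta v b).
Proof. by rewrite dualP => /existsPNP. Qed.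

Lemma dualK X : olattice X -> dual (dual X) = X.
Proof.
move=> latX; have [g [ug gX]] := olattice_basis latX.
have [q0 qN] := uniformizerXz lambda varpi_unif.
apply/seteqP; split=> [v /dualP ddv|v Xv]; last first.
  by apply/dualP => b /dualP Xb; rewrite betaC; apply: idealN; exact: Xb.
apply/gX => i j; rewrite ord1.
have [u uP] := beta_represents (varpi ^ lambda *: row i (invmx g)).
have beta_u w : beta w u = varpi ^ lambda * (invmx g *m w) i 0.
  by rewrite uP -scalemxAl mxE -row_mul mxE.
apply/(idealMnav _ _ q0); rewrite -beta_u qN addr0; apply: ddv.
apply/dualP => b /gX Ob; rewrite betaC beta_u; apply: idealN.
by have /(idealMnav _ _ q0) := Ob i 0; rewrite qN addr0.
Qed.

Variables A B : set W.
Hypothesis B_good : good_lattice beta varpi lambda B.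
Hypothesis A_self_dual : self_dual_lattice beta varpi lambda A.
Hypotheses (sub_BA : B `<=` A) (sub_ABs : A `<=` dual B).
Local Notation Bs := (dual B).

Lemma A_lattice : lattice A. Proof. by have [] := A_self_dual. Qed.

Lemma A_olattice : olattice A. Proof. exact: lattice_olattice A_lattice. Qed.

Lemma A_omodule : omodule A. Proof. by have [] := A_olattice. Qed.

Lemma dual_A : dual A = A. Proof. by have [_ <-] := A_self_dual. Qed.

Lemma B_olattice : olattice B.
Proof. by have [/lattice_olattice] := B_good. Qed.

Lemma B_omodule : omodule B. Proof. by have [] := B_olattice. Qed.

Lemma dual_Bs : dual Bs = B. Proof. exact: dualK B_olattice. Qed.

Lemma beta_dual X u v : dual X u -> X v -> ideal lambda (beta u v).
Proof. by move=> /dualP; exact. Qed.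

Lemma beta_AA u v : A u -> A v -> ideal lambda (beta u v).
Proof. by rewrite -{1}dual_A; exact: beta_dual. Qed.

Lemma beta_BBs u v : B u -> Bs v -> ideal lambda (beta u v).
Proof. by rewrite -{1}dual_Bs; exact: beta_dual. Qed.

Lemma scale_Bs_B c v : ideal 1 c -> Bs v -> B (c *: v).
Proof.
move=> c1 Bsv; have [_ varpiB _] := B_good.
rewrite -(divfK varpi_neq0 c) -scalerA; apply: (omoduleZ B_omodule).
  by apply/ideal_div; rewrite ?varpi_neq0 // nav_varpi addr0.
by apply: (varpiB (varpi *: v)); exists v.
Qed.

Lemma varpi_Bs_B v : Bs v -> B (varpi *: v).
Proof. by apply: scale_Bs_B; rewrite -nav_varpi; exact: ideal_nav. Qed.

Lemma Bs_olattice : olattice Bs.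
Proof.
apply: (olattice_between varpi_neq0 A_olattice (dual_omodule B) sub_ABs).
by move=> v /varpi_Bs_B /sub_BA.
Qed.

Lemma quot_dim_gt0_BsB l : quot_dim Bs B (2 * l) -> (0 < l)%N <-> ~ (Bs `<=` B).
Proof.
move=> [b [Bs_b b_gen b_free]]; split=> [l_gt0 Bs_B|nBsB].
  have l2_gt0 : (0 < 2 * l)%N by rewrite muln_gt0.
  have := b_free (fun=> 1) (fun=> ideal1 k) _ (Ordinal l2_gt0).
  rewrite red1 => red1_0; case/eqP: (oner_neq0 (residue k)); apply: red1_0.
  by apply: (omodule_sum B_omodule) => i _; rewrite scale1r; exact: Bs_B.
case: l b Bs_b b_gen b_free => // b _ b_gen _; case: nBsB => v /b_gen [c [_]].
by rewrite big1 ?subr0 // => -[].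
Qed.

Lemma quot_dim_gt0_AB l : quot_dim Bs B (2 * l) -> (0 < l)%N <-> ~ (A `<=` B).
Proof.
move=> /quot_dim_gt0_BsB ->; split; apply: contra_not => sub.
  have : Bs `<=` dual A by exact: dual_sub.
  by rewrite dual_A => BsA; exact: subset_trans sub.
exact: subset_trans sub.
Qed.

Lemma quot_dim_gt0_BsA l : quot_dim Bs B (2 * l) -> (0 < l)%N <-> ~ (Bs `<=` A).
Proof.
move=> /quot_dim_gt0_BsB ->; split; apply: contra_not => sub;
  last exact: subset_trans sub _.
by apply: (subset_trans sub); rewrite -dual_A -dual_Bs; exact: dual_sub.
Qed.

Lemma quot_dim_ltn l :
  quot_dim Bs B (2 * l) -> (2 * l < n)%N <-> ~ (B `<=` scale_set varpi Bs).
Proof.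
move=> [b].
apply: quot_basis_ltn => //; [exact: Bs_olattice|exact: B_omodule| |].
  by move=> _ [v Bsv <-]; exact: varpi_Bs_B.
exact: subset_trans sub_ABs.
Qed.

(** * The group P_B and its transitivity *)

Local Notation G := (P_B beta A B).

Lemma stabE X g : stab beta X g <-> Sp beta g /\ forall w, X (g *m w) <-> X w.
Proof.
split=> [[Sp_g gX]|[Sp_g gX]]; split=> //; have ug := Sp_unit Sp_g.
  move=> w; split=> [|Xw]; last by rewrite -gX; exists w.
  by rewrite -{1}gX => -[v Xv /(can_inj (mulKmx ug)) <-].
apply/seteqP; split=> [_ [w Xw <-]|w Xw]; first exact/gX.
by exists (invmx g *m w); [apply/gX; rewrite mulKVmx|rewrite mulKVmx].
Qed.

Lemma stab_subgroup X : matrix_subgroup (stab beta X).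
Proof.
split=> [|g h /stabE [Sp_g gX] /stabE [Sp_h hX]|g /stabE [Sp_g gX]].
- by apply/stabE; split=> [u v|w]; rewrite !mul1mx.
- by apply/stabE; split=> [u v|w]; rewrite -!mulmxA ?Sp_g // gX.
- have ug := Sp_unit Sp_g; split=> //; apply/stabE; split=> [u v|w].
    by rewrite -[LHS]Sp_g !mulKVmx.
  by rewrite -gX mulKVmx.
Qed.

Lemma stabN X g : omodule X -> stab beta X g -> stab beta X (- g).
Proof.
move=> modX /stabE [Sp_g gX]; apply/stabE; split=> [u v|w].
  by rewrite !mulNmx !betaE opprK.
by rewrite mulNmx (omoduleN modX).
Qed.

Lemma P_B_subgroup : matrix_subgroup G.
Proof. by apply: matrix_subgroupI; exact: stab_subgroup. Qed.

Lemma P_B1 : G 1%:M. Proof. by have [] := P_B_subgroup. Qed.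

Lemma P_BM g h : G g -> G h -> G (g *m h).
Proof. by have [_ GM _] := P_B_subgroup; exact: GM. Qed.

Lemma P_B_unit g : G g -> g \in unitmx.
Proof. by have [_ _ GV] := P_B_subgroup => /GV []. Qed.

Lemma P_BV g : G g -> G (invmx g).
Proof. by have [_ _ GV] := P_B_subgroup => /GV []. Qed.

Lemma P_BN g : G g -> G (- g).
Proof.
by move=> [gA gB]; split; apply: stabN => //;
  [exact: A_omodule|exact: B_omodule].
Qed.

Lemma P_B_Sp g : G g -> Sp beta g. Proof. by move=> [[]]. Qed.

Lemma P_B_A g w : G g -> A (g *m w) <-> A w.
Proof. by move=> [/stabE []]. Qed.

Lemma P_B_B g w : G g -> B (g *m w) <-> B w.
Proof. by move=> [_ /stabE []]. Qed.

Lemma P_B_Bs g w : G g -> Bs (g *m w) <-> Bs w.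
Proof.
move=> Gg; have Sp_g := P_B_Sp Gg.
split=> /dualP dw; apply/dualP => b Bb.
  by rewrite -Sp_g; apply: dw; exact/P_B_B.
rewrite -(mulKVmx (P_B_unit Gg) b) Sp_g; apply: dw.
by apply/P_B_B => //; exact: P_BV.
Qed.

Lemma P_B_mx_of_fun (f f' : W -> W) : linear f ->
  (forall u v, beta (f u) (f v) = beta u v) -> cancel f' f ->
  (forall L, L = A \/ L = B -> forall w, L w -> L (f w) /\ L (f' w)) ->
  G (mx_of_fun f).
Proof.
move=> lin_f iso_f f'K stable.
have stab_f L : L = A \/ L = B -> stab beta L (mx_of_fun f).
  move=> /(stable L) Lf; split; first by move=> u v; rewrite !mul_mx_of_fun.
  apply/seteqP; split=> [_ [w /Lf [Lfw _] <-]|w /Lf [_ Lf'w]].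
    by rewrite mul_mx_of_fun.
  by exists (f' w); rewrite // mul_mx_of_fun.
by split; apply: stab_f; [left|right].
Qed.

Definition minimal_pairing v b := beta v b != 0 /\ nav (beta v b) = lambda.

Definition shear_compatible L X b := forall s w x, s != 0 -> nav s = lambda ->
  L w -> X x -> L ((beta w b / s) *: x) /\ L ((beta w x / s) *: b).

Lemma shear_mem L X v v' b w : omodule L -> omodule X ->
  shear_compatible L X b -> X v -> X v' -> minimal_pairing v b ->
  minimal_pairing v' b -> L w -> L (shear v v' b w).
Proof.
move=> modL modX compat Xv Xv' [vb0 vbN] [v'b0 v'bN] Lw.
have Xd : X (v' - v) by exact: omoduleB.
have [Ld _] := compat _ _ _ vb0 vbN Lw Xd.
have [_ Lb] := compat _ _ _ v'b0 v'bN Lw Xd.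
have [Lv _] := compat _ _ _ vb0 vbN Lw Xv.
have [_ Lvb] := compat _ _ _ v'b0 v'bN Lv Xv'.
apply: (omoduleD modL); first exact: omoduleD.
by rewrite scalerBl mulrA -betaZl; exact: omoduleB.
Qed.

Lemma avoid_ideals Z N v v' : omodule Z ->
  (exists2 z, Z z & ~ ideal N (beta v z)) ->
  (exists2 z, Z z & ~ ideal N (beta v' z)) ->
  exists z, [/\ Z z, ~ ideal N (beta v z) & ~ ideal N (beta v' z)].
Proof.
move=> modZ [z Zz vz] [z' Zz' v'z'].
have [v'z|] := pselect (ideal N (beta v' z)); last by exists z.
have [vz'|] := pselect (ideal N (beta v z')); last by exists z'.
exists (z + z'); split; first exact: omoduleD.
  by rewrite betaE => vzz'; apply: vz; rewrite -(addrK (beta v z') (beta v z));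
    exact: idealB.
by rewrite betaE addrC => v'zz'; apply: v'z';
  rewrite -(addrK (beta v' z) (beta v' z')); exact: idealB.
Qed.

Lemma P_B_transitive X Z v v' : omodule X -> omodule Z -> X `<=` dual Z ->
  (forall z, Z z -> shear_compatible A X z /\ shear_compatible B X z) ->
  X v -> (exists2 z, Z z & ~ ideal (lambda + 1) (beta v z)) ->
  X v' -> (exists2 z, Z z & ~ ideal (lambda + 1) (beta v' z)) ->
  exists2 g, G g & g *m v = v'.
Proof.
move=> modX modZ XZ compat Xv vZ Xv' v'Z.
have [b [Zb vb v'b]] := avoid_ideals modZ vZ v'Z.
have pair_v : minimal_pairing v b by exact: nav_eq (beta_dual (XZ _ Xv) Zb) vb.
have pair_v' : minimal_pairing v' b.
  by exact: nav_eq (beta_dual (XZ _ Xv') Zb) v'b.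
have [vb0 _] := pair_v; have [v'b0 _] := pair_v'.
exists (mx_of_fun (shear v v' b)); last first.
  by rewrite mul_mx_of_fun; [exact: shear_moves|exact: shear_linear].
apply: (P_B_mx_of_fun (f' := shear v' v b));
  [exact: shear_linear| |exact: shearK|].
  by move=> u w; exact: shear_isometry.
have [compatA compatB] := compat b Zb.
have stable L : omodule L -> shear_compatible L X b ->
    forall w, L w -> L (shear v v' b w) /\ L (shear v' v b w).
  by move=> modL compatL w Lw; split; apply: shear_mem modX compatL _ _ _ _ _.
move=> L [->|->]; apply: stable => //; [exact: A_omodule|exact: B_omodule].
Qed.

Lemma ideal_pairing s w x N : s != 0 -> nav s = lambda ->
  ideal (lambda + N) (beta w x) -> ideal N (beta w x / s).
Proof. by move=> s0 sN wx; apply/ideal_div; rewrite // sN. Qed.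

Lemma ideal_pairing_varpi s w x N : s != 0 -> nav s = lambda ->
  ideal (lambda + N) (beta w x) -> ideal (1 + N) (beta w (varpi *: x) / s).
Proof.
by rewrite betaZr -mulrA => s0 sN wx; exact/ideal_varpiM/ideal_pairing.
Qed.

Lemma dual_witness_varpi Y v : ~ dual Y v ->
  exists2 z, scale_set varpi Y z & ~ ideal (lambda + 1) (beta v z).
Proof.
move=> /dual_witness [y Yy vy]; exists (varpi *: y); first by exists y.
by rewrite betaZr addrC ideal_varpiM.
Qed.

Lemma scale_varpi_omodule X : omodule X -> omodule (scale_set varpi X).
Proof.
by move=> modX; rewrite scale_setE ?varpi_neq0 //; exact: omodule_preim_scale.
Qed.

Lemma P_B_transitive_A v v' : A v -> ~ B v -> A v' -> ~ B v' ->
  exists2 g, G g & g *m v = v'.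
Proof.
rewrite -{1 2}dual_Bs => Av /dual_witness_varpi vZ Av' /dual_witness_varpi v'Z.
apply: P_B_transitive vZ Av' v'Z => //; first exact: A_omodule.
- exact/scale_varpi_omodule/dual_omodule.
- apply: subset_trans sub_ABs _; apply: dual_sub => _ [y Bsy <-].
  exact: varpi_Bs_B.
- move=> _ [y Bsy <-]; have By := varpi_Bs_B Bsy; have Ay := sub_BA By.
  split=> s w x s0 sN Lw Ax.
    by split; apply: (omoduleZ A_omodule) => //; apply: ideal_pairing => //;
      rewrite addr0; exact: beta_AA.
  split; last first.
    apply: (omoduleZ B_omodule) => //; apply: ideal_pairing => //.
    by rewrite addr0; apply: beta_AA => //; exact: sub_BA.
  apply: scale_Bs_B; last exact: sub_ABs.
  by apply: (ideal_pairing_varpi (N := 0)) => //; rewrite addr0;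
    exact: beta_BBs.
Qed.

Lemma P_B_transitive_Bs v v' : Bs v -> ~ A v -> Bs v' -> ~ A v' ->
  exists2 g, G g & g *m v = v'.
Proof.
rewrite -{1 2}dual_A => Bsv /dual_witness_varpi vZ Bsv' /dual_witness_varpi v'Z.
apply: P_B_transitive vZ Bsv' v'Z => //; first exact: dual_omodule.
- exact/scale_varpi_omodule/A_omodule.
- by apply: dual_sub => _ [y /sub_ABs Bsy <-]; exact: varpi_Bs_B.
- move=> _ [y Ay <-]; have By := varpi_Bs_B (sub_ABs Ay).
  have scale_x s w x : s != 0 -> nav s = lambda -> A w -> Bs x ->
      B ((beta w (varpi *: y) / s) *: x).
    move=> s0 sN Aw.
    apply: scale_Bs_B; apply: (ideal_pairing_varpi (N := 0)) => //.
    by rewrite addr0; exact: beta_AA.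
  split=> s w x s0 sN Lw Bsx.
    split; first exact/sub_BA/scale_x.
    rewrite scalerA mulrC mulrA -betaZr; apply: (omoduleZ A_omodule) => //.
    apply: ideal_pairing => //; rewrite addr0; apply: beta_AA => //.
    exact/sub_BA/varpi_Bs_B.
  split; first by apply: scale_x => //; exact: sub_BA.
  apply: (omoduleZ B_omodule) => //; apply: ideal_pairing => //.
  by rewrite addr0; exact: beta_BBs.
Qed.

Lemma P_B_transitive_B v v' : B v -> ~ Bs (varpi^-1 *: v) ->
  B v' -> ~ Bs (varpi^-1 *: v') -> exists2 g, G g & g *m v = v'.
Proof.
have witness u : ~ Bs (varpi^-1 *: u) ->
  exists2 z, B z & ~ ideal (lambda + 1) (beta u z).
  move=> /dual_witness [z Bz uz]; exists z => //.
  by rewrite addrC -(mulVKf varpi_neq0 (beta u z)) ideal_varpiM -betaZl.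
move=> Bv /witness vZ Bv' /witness v'Z.
apply: P_B_transitive vZ Bv' v'Z => //; [exact: B_omodule|exact: B_omodule| |].
  exact: subset_trans sub_ABs.
have compat L : omodule L -> B `<=` L -> L `<=` A -> forall b, B b ->
    shear_compatible L B b.
  move=> modL BL LA b Bb s w x s0 sN /LA Aw Bx.
  by split; apply: (BL _ (omoduleZ B_omodule _ _)) => //;
    apply: ideal_pairing => //;
    rewrite addr0; apply: beta_AA => //; exact: sub_BA.
by move=> b Bb; split; apply: compat => //; [exact: A_omodule|exact: B_omodule].
Qed.

(** * The chain A, B^*, varpi^-1 B, varpi^-1 A, ... *)

Fixpoint chain (i : nat) : set W :=
  match i with
  | 0 => A
  | 1 => Bs
  | 2 => [set w | B (varpi *: w)]
  | i'.+3 => [set w | chain i' (varpi *: w)]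
  end.

Lemma nat_ind3 (P : nat -> Prop) :
  P 0%N -> P 1%N -> P 2%N -> (forall i, P i -> P i.+3) -> forall i, P i.
Proof.
move=> P0 P1 P2 P3 i; suff : [/\ P i, P i.+1 & P i.+2] by case.
by elim: i => [//|i [Pi Pi1 Pi2]]; split=> //; exact: P3.
Qed.

Lemma chain_omodule i : omodule (chain i).
Proof.
elim/nat_ind3: i => [|||i IH] /=; [exact: A_omodule|exact: dual_omodule| |].
  exact/omodule_preim_scale/B_omodule.
exact: omodule_preim_scale.
Qed.

Lemma chainS i : chain i `<=` chain i.+1.
Proof.
elim/nat_ind3: i => [|||i IH] w /=;
  [exact: sub_ABs|exact: varpi_Bs_B|exact: sub_BA|].
exact: IH.
Qed.

Lemma chain_le i j : (i <= j)%N -> chain i `<=` chain j.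
Proof.
move=> /subnK <-.
by elim: (j - i)%N => [|d IH] //= w /IH; exact: chainS.
Qed.

Lemma A_chain i : A `<=` chain i. Proof. exact: (chain_le (leq0n i)). Qed.

Lemma P_B_chain i g w : G g -> chain i (g *m w) <-> chain i w.
Proof.
move=> Gg; elim/nat_ind3: i w => [|||i IH] w /=; rewrite ?scalemxAr //.
- exact: P_B_A.
- exact: P_B_Bs.
- exact: P_B_B.
Qed.

Lemma chain_mul3 m i w : chain (3 * m + i) w <-> chain i (varpi ^+ m *: w).
Proof.
elim: m w => [|m IH] w; first by rewrite muln0 expr0 scale1r.
rewrite (_ : 3 * m.+1 + i = (3 * m + i).+3)%N; last by lia.
by rewrite /= IH scalerA -exprSr.
Qed.

Lemma chain_scale_A i w : chain i w -> A (varpi ^+ i *: w).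
Proof.
move=> /(@chain_le i (3 * i + 0)) cw; apply/(chain_mul3 i 0)/cw; lia.
Qed.

Lemma chain_exhaust w : exists i, chain i w.
Proof.
have [_ [N NA] _] := A_olattice; have [M Mw] := ball_mx_exhaust w.
pose i := absz (N - M)%R; exists (3 * i + 0)%N; apply/chain_mul3/NA.
apply: (@ball_mx_le _ _ _ _ (i%:Z + M)); first by lia.
by rewrite -nav_varpiX; apply/ball_mxZ => //; exact: varpiX_neq0.
Qed.

Definition level (i : nat) : set W :=
  chain i `\` (if i is i'.+1 then chain i' else set0).

Lemma level0 : level 0 = A. Proof. exact: setD0. Qed.

Lemma level_ex w : exists i, level i w.
Proof.
have exP : exists i, `[< chain i w >].
  by have [i iw] := chain_exhaust w; exists i; apply/asboolP.
have [i /asboolP iw imin] := ex_minnP exP; exists i; split=> //.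
case: i imin {iw} => [|i] imin; first by [].
by move=> /asboolP /imin; rewrite ltnn.
Qed.

Lemma level_inj i j w : level i w -> level j w -> i = j.
Proof.
have level_leq (a b : nat) : level a w -> level b w -> (a <= b)%N.
  move=> [_ wa] [wb _]; rewrite leqNgt; apply/negP => ltba.
  by case: a wa ltba => // a wa ltba; apply: wa; apply: chain_le wb.
by move=> iw jw; apply/eqP; rewrite eqn_leq !level_leq.
Qed.

Lemma level_congr i v w :
  (forall j, chain j v <-> chain j w) -> level i v <-> level i w.
Proof.
have half u u' :
    (forall j, chain j u <-> chain j u') -> level i u -> level i u'.
  move=> uu' [iu niu]; split; first exact/uu'.
  by case: i niu {iu} => // j nju /uu'.
by move=> vw; split; apply: half => j; split=> /vw.
Qed.

Lemma level_eqA i v w : A (v - w) -> level i v <-> level i w.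
Proof.
move=> Avw; apply: level_congr => j.
by rewrite -{1}(subrK w v); apply/(omoduleDl (chain_omodule j))/A_chain.
Qed.

Lemma levelN i w : level i (- w) <-> level i w.
Proof. by apply: level_congr => j; exact/omoduleN/chain_omodule. Qed.

Lemma P_B_level i g w : G g -> level i (g *m w) <-> level i w.
Proof. by move=> Gg; apply: level_congr => j; exact: P_B_chain. Qed.

Lemma level_gt0_notA i w : (0 < i)%N -> level i w -> ~ A w.
Proof. by case: i => // i _ [_ nw] Aw; apply: nw; exact: A_chain. Qed.

Lemma level_finite_cover i X : omodule X -> (exists N, ball_mx N `<=` X) ->
  exists r : seq W, forall w, level i w -> exists2 x, x \in r & X (w - x).
Proof.
move=> modX openX.
have [r rP] := lattice_finite_cover A_lattice modX openX (varpiX_neq0 i).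
by exists r => w [/chain_scale_A /rP].
Qed.

Lemma level_transitive i v v' : level i v -> level i v' ->
  exists2 g, G g & A (g *m v - v').
Proof.
case: i => [|i].
  rewrite level0 => Av Av'; exists 1%:M; first exact: P_B1.
  by rewrite mul1mx; exact: (omoduleB A_omodule).
move=> iv iv'; suff [g Gg <-] : exists2 g, G g & g *m v = v'.
  by exists g; rewrite // subrr; exact: omodule0 A_omodule.
have unscale u u' : (exists2 g, G g & g *m (varpi *: u) = varpi *: u') ->
    exists2 g, G g & g *m u = u'.
  move=> [g Gg]; rewrite -scalemxAr => /(can_inj (scalerK varpi_neq0)) gu.
  by exists g.
elim/nat_ind3: i v v' iv iv' => [|||i IH] v v'.
- by move=> [Bsv nAv] [Bsv' nAv']; exact: P_B_transitive_Bs.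
- move=> [Bv nBsv] [Bv' nBsv']; apply/unscale/P_B_transitive_B => //;
  by rewrite scalerK ?varpi_neq0.
- by move=> [Av nBv] [Av' nBv']; apply/unscale/P_B_transitive_A.
- by move=> iv iv'; apply/unscale/IH.
Qed.

Definition rank (m : nat) (j : layer_index) : nat :=
  3 * m + match j with j0 => 0 | j2 => 1 | j1 => 2 end.

Lemma rank_inj m j m' j' : rank m j = rank m' j' -> m = m' /\ j = j'.
Proof. by rewrite /rank; case: j; case: j' => eq_rank; split=> //; lia. Qed.

Lemma rank_surj i : exists mj : nat * layer_index, rank mj.1 mj.2 = i.
Proof.
elim/nat_ind3: i => [|||i [[m j] <-]];
  [by exists (0, j0)|by exists (0, j2)|by exists (0, j1)|].
by exists (m.+1, j); rewrite /rank /=; lia.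
Qed.

Lemma level_mul3 m i w :
  level (3 * m + i.+1) w <-> level i.+1 (varpi ^+ m *: w).
Proof.
have := chain_mul3 m i.+1 w; have := chain_mul3 m i w.
rewrite addnS => chain_i chain_iS.
by split=> -[/chain_iS iw niw]; split=> // /chain_i.
Qed.

Lemma scale_varpiVX m X w : scale_set (varpi ^- m) X w <-> X (varpi ^+ m *: w).
Proof. by rewrite scale_setE ?invr_eq0 ?varpiX_neq0 //= invrK. Qed.

Lemma layerE m j : (0 < rank m j)%N ->
  layer varpi lambda beta A B m j = level (rank m j).
Proof.
move=> rank_gt0; apply/seteqP.
suff layer_level w : layer varpi lambda beta A B m j w <-> level (rank m j) w.
  by split=> w /layer_level.
case: j rank_gt0 => /=; rewrite /rank.
- case: m => // m _; rewrite (_ : 3 * m.+1 + 0 = 3 * m + 3)%N; last by lia.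
  by rewrite level_mul3 /level /setD /= !scale_varpiVX !scalerA -!exprS.
- by rewrite level_mul3 /level /setD /= !scale_varpiVX !scalerA -!exprS.
- by rewrite level_mul3 /level /setD /= !scale_varpiVX.
Qed.

Lemma level_nonempty m i :
  (exists w, level (3 * m + i.+1) w) <-> ~ (chain i.+1 `<=` chain i).
Proof.
rewrite -existsPNP; split=> [[w /level_mul3 [ciw nciw]]|[w ciw nciw]].
  by exists (varpi ^+ m *: w).
exists (varpi ^- m *: w); apply/level_mul3.
by rewrite scalerA divff ?varpiX_neq0 // scale1r.
Qed.

Lemma level_j0_nonempty l m : quot_dim Bs B (2 * l) ->
  (exists w, level (rank m.+1 j0) w) <-> (0 < l)%N.
Proof.
move=> /quot_dim_gt0_AB ->; rewrite (_ : rank m.+1 j0 = 3 * m + 3)%N;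
  last by rewrite /rank; lia.
rewrite level_nonempty; split; apply: contra_not => sub w; first exact: sub.
by move=> Aw; have := sub (varpi^-1 *: w);
  rewrite /= scalerA divff ?varpi_neq0 // scale1r; apply.
Qed.

Lemma level_j1_nonempty l m : quot_dim Bs B (2 * l) ->
  (exists w, level (rank m j1) w) <-> (2 * l < n)%N.
Proof.
move=> /quot_dim_ltn ->; rewrite level_nonempty scale_setE ?varpi_neq0 //.
split; apply: contra_not => sub w /= Bw.
  by have := sub _ Bw; rewrite /= scalerK ?varpi_neq0.
by apply: sub; rewrite /= scalerA divff ?varpi_neq0 // scale1r.
Qed.

Lemma level_j2_nonempty l m : quot_dim Bs B (2 * l) ->
  (exists w, level (rank m j2) w) <-> (0 < l)%N.
Proof. by move=> /quot_dim_gt0_BsA ->; exact: level_nonempty. Qed.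

(** * Separation of cosets by the characters of their stabilizers *)

Variables (R : realType) (psi : k -> R[i]).
Local Notation C := R[i].
Local Notation H := (Hspace psi beta A).
Hypothesis char2 : 2%N \notin [pchar (residue k)].
Hypotheses (psi_char : unitary_character psi)
  (psi_cond : has_conductor varpi psi lambda).
Implicit Types f : W -> C.

Lemma psiD x y : psi (x + y) = psi x * psi y.
Proof. by have [psiD _ _] := psi_char. Qed.

Lemma psi_norm x : `|psi x| = 1.
Proof. by have [_ psi_norm _] := psi_char. Qed.

Lemma psi_neq0 x : psi x != 0.
Proof. by rewrite -normr_eq0 psi_norm oner_neq0. Qed.

Lemma psi_ideal x : ideal lambda x -> psi x = 1.
Proof.
by have [psi1 _] := psi_cond; rewrite -(frac_idealE _ varpi_unif); exact: psi1.
Qed.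

Lemma psi0 : psi 0 = 1. Proof. by apply: psi_ideal; exact: ideal0. Qed.

Lemma psiN x : psi (- x) = (psi x)^-1.
Proof.
by apply: (mulIf (psi_neq0 x)); rewrite mulVf ?psi_neq0 // -psiD addNr psi0.
Qed.

Lemma psi_congr x y : ideal lambda (x - y) -> psi x = psi y.
Proof. by move=> /psi_ideal xy; rewrite -(subrK y x) psiD xy mul1r. Qed.

Lemma transvection_P_B t u :
  A u -> ideal (1 - lambda) t -> G (mx_of_fun (transvection t u)).
Proof.
move=> Au tN; have trans_mem t' L w : ideal (1 - lambda) t' -> L = A \/ L = B ->
    L w -> L (transvection t' u w).
  move=> t'N L_AB Lw; have [modL BL LA] : [/\ omodule L, B `<=` L & L `<=` A].
    by case: L_AB => ->; split=> //; [exact: A_omodule|exact: B_omodule].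
  apply: (omoduleD modL) => //; apply: BL; apply: scale_Bs_B;
    last exact: sub_ABs.
  by rewrite -(subrK lambda 1); apply: idealM => //; apply: beta_AA => //;
    exact: LA.
apply: (P_B_mx_of_fun (f' := transvection (- t) u)).
- exact: transvection_linear.
- exact: transvection_isometry.
- exact: transvectionK.
- by move=> L L_AB w Lw; split; apply: trans_mem => //; exact: idealN.
Qed.

Lemma transvection_P_v t u v : A u -> ideal (1 - lambda) t ->
  ideal 0 (t * beta v u) -> P_v beta A B v (mx_of_fun (transvection t u)).
Proof.
move=> Au tN tvu; split; first exact: transvection_P_B.
rewrite mul_mx_of_fun; last exact: transvection_linear.
by rewrite /transvection addrC addKr; exact: (omoduleZ A_omodule).
Qed.

Lemma chi_v_transvection t u v :
  chi_v psi beta v (mx_of_fun (transvection t u)) =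
    psi (- (2^-1 * (t * beta v u ^+ 2))).
Proof.
rewrite /chi_v mul_mx_of_fun; last exact: transvection_linear.
by rewrite /transvection !betaE (betaC u v); congr psi; ring.
Qed.

Lemma separating_scalar x y c (t := 2 * c / (x * y)) :
  x != 0 -> nav x < lambda -> y != 0 -> nav y < lambda ->
  ideal (lambda - 1) c ->
  [/\ ideal (1 - lambda) t, ideal 0 (t * x) & ideal 0 (t * y)].
Proof.
move=> x0 xN y0 yN cN; have [two0 two1] := nav2 char2.
have O2 : ideal 0 (2 : k) by right; rewrite two1.
have quot_int s : s != 0 -> nav s < lambda -> ideal 0 (2 * c / s).
  move=> s0 sN; rewrite -mulrA; apply: idealMl => //; apply/ideal_div => //.
  by apply: ideal_le cN; lia.
have tx : t * x = 2 * c / y by rewrite /t; field; rewrite x0 y0.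
have ty : t * y = 2 * c / x by rewrite /t; field; rewrite x0 y0.
split; rewrite ?tx ?ty; [|exact: quot_int|exact: quot_int].
have -> : t = t * x / x by field.
apply/ideal_div => //; rewrite tx; apply: ideal_le (quot_int y y0 yN); lia.
Qed.

(* On the transvection [w + t beta(w, u) u], the quotient of the two          *)
(* characters is [psi (- t beta(v - v', u) beta(v + v', u) / 2)].             *)
Lemma separation v v' : ~ A (v - v') -> ~ A (v + v') ->
  exists h, [/\ P_v beta A B v h, P_v beta A B v' h &
    chi_v psi beta v h <> chi_v psi beta v' h].
Proof.
have [two0 _] := nav2 char2.
rewrite -{1 2}dual_A => /dual_witness vN /dual_witness vD.
have [u [Au /not_ideal [x0 xN] /not_ideal [y0 yN]]] :=
  avoid_ideals A_omodule vN vD.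
have [_ [c]] := psi_cond; rewrite frac_idealE // => cN psi_c.
have [] := separating_scalar x0 xN y0 yN cN.
set x := beta (v - v') u in x0 *; set y := beta (v + v') u in y0 *.
set t := _ / _ => tN tx ty.
exists (mx_of_fun (transvection t u)); split.
- apply: transvection_P_v => //.
  have -> : t * beta v u = 2^-1 * (t * x + t * y).
    by rewrite /x /y !betaE; field.
  by apply: ideal_half => //; exact: idealD.
- apply: transvection_P_v => //.
  have -> : t * beta v' u = 2^-1 * (t * y - t * x).
    by rewrite /x /y !betaE; field.
  by apply: ideal_half => //; exact: idealB.
rewrite !chi_v_transvection => chi_eq; apply: psi_c.
have -> : c = 2^-1 * (t * beta v u ^+ 2) - 2^-1 * (t * beta v' u ^+ 2).
  transitivity (2^-1 * t * (x * y));
    first by rewrite /t; field; rewrite two0 x0 y0.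
  by rewrite /x /y !betaE; ring.
by rewrite psiD -chi_eq -psiD subrr psi0.
Qed.

(** * Functions supported on a level *)

Lemma cosets_ex w : exists2 t, cosets A t & A (t - w).
Proof.
apply: (@transversal_ex _ 0 setT (fun x y : W => A (y - x))) => // x _.
by rewrite subrr; exact: (omodule0 A_omodule).
Qed.

Lemma cosets_inj t t' : cosets A t -> cosets A t' -> A (t - t') -> t = t'.
Proof.
move=> tA t'A /(omodule_subC A_omodule); apply: transversal_inj tA t'A => //.
- by move=> x _; rewrite subrr; exact: (omodule0 A_omodule).
- by move=> x y _ _ /(omodule_subC A_omodule).
- by move=> x y z _ _ _ Ayx Azy; exact: (omodule_sub_trans A_omodule) Azy Ayx.
Qed.

Definition equivariant f :=
  forall a w, A a -> f (a + w) = psi (2^-1 * beta w a) * f w.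

Lemma equivariant_congr f v w : equivariant f -> A (v - w) ->
  f v = psi (2^-1 * beta w (v - w)) * f w.
Proof. by move=> eqv_f Avw; rewrite -eqv_f // subrK. Qed.

Lemma equivariant_neq0 f v w :
  equivariant f -> A (v - w) -> f v != 0 -> f w != 0.
Proof.
move=> eqv_f /(equivariant_congr eqv_f) ->.
by rewrite mulf_eq0 negb_or => /andP [].
Qed.

Lemma equivariant_conjM f f' v w :
  equivariant f -> equivariant f' -> A (v - w) ->
  f v * (f' v)^* = f w * (f' w)^*.
Proof.
move=> eqv_f eqv_f' Avw; rewrite (equivariant_congr eqv_f Avw).
rewrite (equivariant_congr eqv_f' Avw) rmorphM mulrACA -normCK psi_norm.
by rewrite expr1n mul1r.
Qed.

Definition level_space (i : nat) : set (W -> C) :=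
  [set f | equivariant f /\ forall w, f w != 0 -> level i w].

Definition parity_space (i : nat) (s : bool) : set (W -> C) :=
  [set f | level_space i f /\ forall w, f (- w) = sgn R s * f w].

Lemma level_space_out i f w : level_space i f -> ~ level i w -> f w = 0.
Proof. by move=> [_ supp_f] niw; have [//|/supp_f] := eqVneq (f w) 0. Qed.

Lemma neq0_fun f : f <> (fun=> 0) -> exists v, f v != 0.
Proof.
move=> f0; apply: contrapT => /forallNP all0; apply: f0; apply/funext => w.
by apply/eqP/negPn/negP; exact: all0.
Qed.

Lemma Hform_seq f f' (r : seq W) : equivariant f -> equivariant f' -> uniq r ->
  (forall v w, v \in r -> w \in r -> A (v - w) -> v = w) ->
  (forall w, f w != 0 -> exists2 v, v \in r & A (v - w)) ->
  Hform A f f' = \sum_(w <- r) f w * (f' w)^*.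
Proof.
move=> eqv_f eqv_f' ur r_inj r_cover.
pose q w := s2val (cid2 (cosets_ex w)).
have q_cosets w : cosets A (q w) by exact: (s2valP (cid2 (cosets_ex w))).
have Aq w : A (q w - w) by exact: (s2valP' (cid2 (cosets_ex w))).
rewrite /Hform /l2_form (@complex_sum_seq _ _ _ (map q r)).
- by rewrite big_map; apply: eq_bigr => w _; exact: equivariant_conjM.
- rewrite map_inj_in_uniq // => v w vr wr eq_q; apply: r_inj => //.
  apply: (omodule_sub_trans A_omodule) (Aq w); rewrite -eq_q.
  exact/(omodule_subC A_omodule).
- by move=> _ /mapP [w _ ->].
- move=> w wA; rewrite mulf_eq0 negb_or => /andP [/r_cover [v vr Avw] _].
  apply/mapP; exists v => //; apply: cosets_inj => //.
  apply/(omodule_subC A_omodule); exact: (omodule_sub_trans A_omodule) Avw.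
Qed.

Lemma level_space_Hspace i f : level_space i f -> H f.
Proof.
move=> [eqv_f supp_f]; split=> //; have [_ openA _] := A_olattice.
have [r r_cover] := level_finite_cover i A_omodule openA.
pose q w := s2val (cid2 (cosets_ex w)).
apply: (@square_summable_seq _ _ _ (map q r)) => w wA.
move=> /supp_f /r_cover [v vr Awv].
apply/mapP; exists v => //; apply: cosets_inj => //.
  exact: (s2valP (cid2 (cosets_ex v))).
apply: (omodule_sub_trans A_omodule) Awv _; apply/(omodule_subC A_omodule).
exact: (s2valP' (cid2 (cosets_ex v))).
Qed.

Lemma parity_space_Hspace i s f : parity_space i s f -> H f.
Proof. by move=> [/level_space_Hspace]. Qed.

Lemma level_space_fsubspace i : fsubspace (level_space i).
Proof.
split=> [|c f g [eqv_f supp_f] [eqv_g supp_g]].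
  by split=> [a w _|w]; rewrite ?mulr0 ?eqxx.
split=> [a w Aa|w]; first by rewrite eqv_f // eqv_g //; ring.
have [->|/supp_f//] := eqVneq (f w) 0; rewrite mulr0 add0r; exact: supp_g.
Qed.

Lemma parity_space_fsubspace i s : fsubspace (parity_space i s).
Proof.
have [V0 VD] := level_space_fsubspace i; split=> [|c f g [Vf fN] [Vg gN]].
  by split=> // w; rewrite mulr0.
by split=> [|w]; [exact: VD|rewrite fN gN; ring].
Qed.

Lemma sgnM s : sgn R s * sgn R s = 1.
Proof. by case: s; rewrite /= ?mulr1 ?mulrNN ?mulr1. Qed.

Lemma sgnV s : (sgn R s)^-1 = sgn R s.
Proof. by case: s; rewrite /= ?invrN1 ?invr1. Qed.

Lemma sgn_inj : injective (sgn R).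
Proof.
have two0 : (2%:R : C) != 0 by rewrite pnatr_eq0.
by case=> [] [] //= /eqP; rewrite ?[-1 == 1]eq_sym -subr_eq0 opprK (negPf two0).
Qed.

Lemma M_mul g h f : G g -> G h -> M_ (g *m h) f = M_ g (M_ h f).
Proof.
move=> /P_B_unit ug /P_B_unit uh; apply/funext => w.
by rewrite /M_ mulmxA invmxM.
Qed.

Lemma M_N1 f w : M_ (- 1%:M) f w = f (- w).
Proof. by rewrite /M_ invmxN invmx1 mulNmx mul1mx. Qed.

Lemma equivariant_M g f : G g -> equivariant f -> equivariant (M_ g f).
Proof.
move=> /P_BV Gg eqv_f a w Aa.
by rewrite /M_ mulmxDr eqv_f ?(P_B_Sp Gg) //; exact/(P_B_A _ Gg).
Qed.

Lemma parity_space_M i s g f : G g -> parity_space i s f ->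
  parity_space i s (M_ g f).
Proof.
move=> Gg [[eqv_f supp_f] fN]; split=> [|w]; last by rewrite /M_ mulmxN fN.
split=> [|w]; first exact: equivariant_M.
by move=> /supp_f /(P_B_level _ _ (P_BV Gg)).
Qed.

Lemma P_v_subgroup v : matrix_subgroup (P_v beta A B v).
Proof.
split=> [|g h [Gg Ag] [Gh Ah]|g [Gg Ag]].
- by split; [exact: P_B1|rewrite mul1mx subrr; exact: (omodule0 A_omodule)].
- split; first exact: P_BM.
  apply: (omodule_sub_trans A_omodule) Ag; rewrite -mulmxA -mulmxBr.
  exact/(P_B_A _ Gg).
- have ug := P_B_unit Gg; split=> //; split; first exact: P_BV.
  by apply/(P_B_A _ Gg); rewrite mulmxBr mulKVmx //;
    exact/(omodule_subC A_omodule).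
Qed.

Lemma P_v1 v : P_v beta A B v 1%:M. Proof. by have [] := P_v_subgroup v. Qed.

Lemma P_vM v g h : P_v beta A B v g -> P_v beta A B v h ->
  P_v beta A B v (g *m h).
Proof. by have [_ + _] := P_v_subgroup v; apply. Qed.

Lemma P_vV v g : P_v beta A B v g -> P_v beta A B v (invmx g).
Proof. by have [_ _ PV] := P_v_subgroup v => /PV []. Qed.

Lemma chi_v_neq0 v h : chi_v psi beta v h != 0. Proof. exact: psi_neq0. Qed.

Lemma equivariant_P_v f v x h : equivariant f -> G x -> P_v beta A B v h ->
  f (x *m (h *m v)) = (chi_v psi beta v h)^-1 * f (x *m v).
Proof.
move=> eqv_f Gx [Gh Ah]; have Axh : A (x *m (h *m v) - x *m v).
  by rewrite -mulmxBr; exact/(P_B_A _ Gx).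
rewrite (equivariant_congr eqv_f Axh) -mulmxBr (P_B_Sp Gx) /chi_v -psiN.
by congr (psi _ * _); rewrite !betaE (betaC v) subr0 mulrN.
Qed.

Lemma M_P_v f v h : equivariant f -> P_v beta A B v h ->
  M_ h f v = chi_v psi beta v h * f v.
Proof.
move=> eqv_f Ph; have [Gh _] := Ph; rewrite /M_.
have := equivariant_P_v eqv_f (P_BV Gh) Ph.
by rewrite mulKmx ?P_B_unit // => ->; rewrite mulVKf // chi_v_neq0.
Qed.

Definition concentrated v f := forall w, f w != 0 -> A (w - v) \/ A (w + v).

Lemma concentrated_out v f w :
  concentrated v f -> ~ A (w - v) -> ~ A (w + v) -> f w = 0.
Proof. by move=> conc_f nA nA'; have [//|/conc_f []] := eqVneq (f w) 0. Qed.

Lemma twisted_concentrated f v : equivariant f ->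
  (forall h, P_v beta A B v h ->
    forall w, M_ h f w = chi_v psi beta v h * f w) ->
  concentrated v f.
Proof.
move=> eqv_f twist_f w fw; apply: contrapT => /not_orP [nA nA'].
have [||h [Phv Phw]] := @separation v w; [|by rewrite addrC|].
  by move=> /(omodule_subC A_omodule).
by apply; have := twist_f h Phv w; rewrite M_P_v // => /(mulIf fw).
Qed.

Lemma concentrated_ext i s v f f' : parity_space i s f -> parity_space i s f' ->
  concentrated v f -> concentrated v f' -> f v = f' v -> f = f'.
Proof.
move=> [[eqv_f _] fN] [[eqv_f' _] f'N] conc_f conc_f' eq_v; apply/funext => w.
have [Awv|nAwv] := pselect (A (w - v)).
  by rewrite (equivariant_congr eqv_f Awv) eq_v -equivariant_congr.
have [|nAwv'] := pselect (A (w + v)); last by rewrite !(@concentrated_out v).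
rewrite -{1}[v]opprK => Awv'.
rewrite (equivariant_congr eqv_f Awv') (equivariant_congr eqv_f' Awv').
by rewrite fN f'N eq_v.
Qed.

Lemma concentrated_M v x g f : G g -> A (g *m v - x) -> concentrated v f ->
  concentrated x (M_ g f).
Proof.
move=> Gg Agv conc_f w; have ug := P_B_unit Gg.
move=> /conc_f [] /(P_B_A _ Gg); rewrite ?mulmxBr ?mulmxDr mulKVmx // => Aw.
  by left; exact: (omodule_sub_trans A_omodule) Aw Agv.
by right; have := omoduleB A_omodule Aw Agv; rewrite opprB addrACA subrr addr0.
Qed.

Definition delta_coset v w : C :=
  if `[< A (w - v) >] then psi (2^-1 * beta v w) else 0.

Lemma delta_coset_equivariant v : equivariant (delta_coset v).
Proof.
move=> a w Aa; rewrite /delta_coset -addrA.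
have -> : `[< A (a + (w - v)) >] = `[< A (w - v) >].
  by apply/asboolP/asboolP => /(omoduleDl A_omodule _ Aa).
case: asboolP => Awv; last by rewrite mulr0.
rewrite -psiD; apply: psi_congr.
rewrite (_ : _ - _ = 2^-1 * (- beta (w - v) a)); last by rewrite !betaE; ring.
by apply: ideal_half => //; apply: idealN; exact: beta_AA.
Qed.

Lemma chi_vM v g h : P_v beta A B v g -> P_v beta A B v h ->
  chi_v psi beta v (g *m h) = chi_v psi beta v g * chi_v psi beta v h.
Proof.
move=> Pg Ph.
have eqv := delta_coset_equivariant v.
have [[Gg _] [Gh _]] := (Pg, Ph).
have delta_v : delta_coset v v != 0.
  by rewrite /delta_coset asboolT ?psi_neq0 // subrr;
    exact: (omodule0 A_omodule).
apply: (mulIf delta_v); rewrite -M_P_v //; last exact: P_vM.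
by rewrite M_mul // !M_P_v ?mulrA //; exact: equivariant_M.
Qed.

Definition delta_pm v s w : C :=
  delta_coset v w + sgn R s * delta_coset v (- w).

Lemma delta_pm_concentrated v s : concentrated v (delta_pm v s).
Proof.
move=> w; rewrite /delta_pm /delta_coset.
case: asboolP => Awv; first by left.
case: asboolP => [|_]; last by rewrite mulr0 addr0 eqxx.
by rewrite -opprD (omoduleN A_omodule); right.
Qed.

Lemma delta_pm_in i v s : level i v -> parity_space i s (delta_pm v s).
Proof.
move=> iv.
split=> [|w]; last by rewrite /delta_pm opprK mulrDr mulrA sgnM mul1r addrC.
split=> [a w Aa|w /delta_pm_concentrated [Awv|Awv]].
- rewrite /delta_pm delta_coset_equivariant // opprD delta_coset_equivariant;
    last exact/(omoduleN A_omodule).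
  by rewrite !betaE opprK; ring.
- exact/(level_eqA _ Awv).
- by rewrite -{1}[v]opprK in Awv; apply/(level_eqA _ Awv)/levelN.
Qed.

Lemma A_of_double v : A (v + v) -> A v.
Proof.
have [two0 _] := nav2 char2; move=> Avv; rewrite (_ : v = 2^-1 *: (v + v)).
  by apply: (omoduleZ A_omodule) => //; rewrite -[2^-1]mulr1;
    exact: ideal_half (ideal1 k).
by rewrite -mulr2n -scaler_nat scalerA mulVf // scale1r.
Qed.

Lemma delta_pm_center v s : ~ A v -> delta_pm v s v = 1.
Proof.
move=> nAv; rewrite /delta_pm /delta_coset asboolT; last first.
  by rewrite subrr; exact: (omodule0 A_omodule).
rewrite asboolF; first by rewrite !betaE !mulr0 psi0 addr0.
by rewrite -opprD (omoduleN A_omodule) => /A_of_double.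
Qed.

Lemma delta_pm_neq0 v s : (A v -> s = true) -> delta_pm v s v != 0.
Proof.
have [Av /(_ Av) ->|nAv _] := pselect (A v);
  last by rewrite delta_pm_center ?oner_neq0.
rewrite /delta_pm /delta_coset !asboolT.
- by rewrite !betaE oppr0 mulr0 psi0 mulr1 (_ : 1 + 1 = 2%:R) ?pnatr_eq0.
- by rewrite -opprD (omoduleN A_omodule); exact: (omoduleD A_omodule).
- by rewrite subrr; exact: (omodule0 A_omodule).
Qed.

Lemma delta_pm_twisted i v s h : level i v -> P_v beta A B v h ->
  M_ h (delta_pm v s) = (fun w => chi_v psi beta v h * delta_pm v s w).
Proof.
move=> iv Ph; have V := delta_pm_in s iv; have [Gh Ah] := Ph.
apply: (@concentrated_ext i s v).
- exact: parity_space_M.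
- exact: (fsubspaceZ (parity_space_fsubspace i s)).
- exact: concentrated_M Gh Ah (@delta_pm_concentrated v s).
- by move=> w; rewrite mulf_eq0 negb_or => /andP [_ /delta_pm_concentrated].
- by have [[eqv _] _] := V; rewrite M_P_v.
Qed.

(** * Irreducibility *)

Definition periods (i : nat) : set W := [set u | A (varpi ^- i *: u)].

Lemma periods_omodule i : omodule (periods i).
Proof. exact: (omodule_preim_scale A_omodule). Qed.

Lemma periods_A i u : periods i u -> A u.
Proof.
have Oi : ideal 0 (varpi ^+ i) by right; rewrite nav_varpiX.
move=> /(omoduleZ A_omodule Oi).
by rewrite scalerA divff ?varpiX_neq0 // scale1r.
Qed.

Lemma periods_ball i : exists N, ball_mx N `<=` periods i.
Proof.
have [_ [N NA] _] := A_olattice; exists (i%:Z + N) => u Nu; apply: NA.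
rewrite -(ball_mxZ _ _ (varpiX_neq0 i)) nav_varpiX.
by rewrite scalerA divff ?varpiX_neq0 // scale1r.
Qed.

Lemma beta_periods i u w : level i w -> periods i u ->
  ideal lambda (2^-1 * beta w u).
Proof.
move=> [/chain_scale_A iw _] iu; apply: ideal_half => //.
rewrite (_ : beta w u = beta (varpi ^+ i *: w) (varpi ^- i *: u));
  first exact: beta_AA.
by rewrite !betaE mulrCA mulKf // varpiX_neq0.
Qed.

Lemma level_space_periodic i f v w :
  level_space i f -> periods i (v - w) -> f v = f w.
Proof.
move=> Vf vw; have Avw := periods_A vw; have [eqv_f _] := Vf.
have [iw|niw] := pselect (level i w).
  by rewrite (equivariant_congr eqv_f Avw) psi_ideal ?mul1r //;
    exact: beta_periods iw vw.
by rewrite !(level_space_out Vf) // (level_eqA _ Avw).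
Qed.

Lemma level_space_factor i : exists (I : finType) (cls : W -> I),
  forall f v w, level_space i f -> cls v = cls w -> f v = f w.
Proof.
have [r r_cover] := level_finite_cover i (periods_omodule i) (periods_ball i).
pose cl w := find (fun x => `[< periods i (w - x) >]) r.
have cl_lt w : (cl w < (size r).+1)%N by rewrite ltnS find_size.
exists 'I_(size r).+1, (fun w => Ordinal (cl_lt w)) => f v w Vf [eq_cl].
have f_cl u : (cl u < size r)%N -> f u = f r`_(cl u).
  rewrite -has_find => has_u; apply: level_space_periodic Vf _.
  exact/asboolP/(nth_find 0 has_u).
have f_out u : (size r <= cl u)%N -> f u = 0.
  rewrite leqNgt -has_find => /hasPn no_u; apply: level_space_out Vf _.
  by move=> /r_cover [x /no_u /asboolP].
have [lt_v|le_v] := ltnP (cl v) (size r).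
  by rewrite f_cl // [RHS]f_cl -eq_cl.
by rewrite f_out // f_out // -eq_cl.
Qed.

Lemma orbit_finite i s f : parity_space i s f ->
  finite_set [set M_ h f | h in G].
Proof.
move=> Vf; have [I [cls clsP]] := level_space_factor i.
pose repr j := xget 0 [set w | cls w = j].
have cls_repr w : cls (repr (cls w)) = cls w.
  by apply: (@xgetPex _ 0 [set x | cls x = cls w]); exists w.
pose code h : {ffun I -> I} := [ffun j => cls (invmx h *m repr j)].
have codeP h h' : G h -> G h' -> code h = code h' -> M_ h f = M_ h' f.
  move=> Gh Gh' /ffunP eq_code; apply/funext => w.
  have [VMh _] := parity_space_M Gh Vf; have [VMh' _] := parity_space_M Gh' Vf.
  rewrite (clsP _ _ _ VMh (esym (cls_repr w)))
    (clsP _ _ _ VMh' (esym (cls_repr w))).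
  by have [Vf' _] := Vf; apply: clsP Vf' _; have := eq_code (cls w);
    rewrite !ffunE.
pose back a := M_ (xget 1%:M [set h | G h /\ code h = a]) f.
apply: (@sub_finite_set _ _ [set back a | a in setT]);
  last exact/finite_image/finite_finset.
move=> _ [h Gh <-]; exists (code h) => //.
have [|Gx code_x] := @xgetPex _ 1%:M [set g | G g /\ code g = code h];
  first by exists h.
exact: codeP.
Qed.

Definition chi_twist v h f : W -> C :=
  fun w => (chi_v psi beta v h)^-1 * M_ h f w.

Lemma chi_twistM v g h f : P_v beta A B v g -> P_v beta A B v h ->
  chi_twist v (g *m h) f = chi_twist v g (chi_twist v h f).
Proof.
move=> Pg Ph; have [[Gg _] [Gh _]] := (Pg, Ph); apply/funext => w.
by rewrite /chi_twist chi_vM // M_mul // invfM mulrA [_^-1 * _^-1]mulrC.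
Qed.

Lemma chi_twist1 v f : chi_twist v 1%:M f = f.
Proof.
apply/funext => w; rewrite /chi_twist /chi_v /M_ invmx1 !mul1mx betavv mulr0.
by rewrite psi0 invr1 mul1r.
Qed.

Lemma chi_twist_center v h f :
  equivariant f -> P_v beta A B v h -> chi_twist v h f v = f v.
Proof. by move=> eqv_f Ph; rewrite /chi_twist M_P_v // mulKf // chi_v_neq0. Qed.

Lemma chi_twist_inj v h : P_v beta A B v h -> injective (chi_twist v h).
Proof.
move=> Ph f f' /(congr1 (chi_twist v (invmx h))); have [Gh _] := Ph.
by rewrite -!chi_twistM ?mulVmx ?chi_twist1 ?P_B_unit //; exact: P_vV.
Qed.

Definition chi_twisted_orbit v f := [set chi_twist v h f | h in P_v beta A B v].

Lemma chi_twisted_orbit_finite i s f v : parity_space i s f -> f v != 0 ->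
  finite_set (chi_twisted_orbit v f).
Proof.
move=> Vf fv; have [[eqv_f _] _] := Vf.
apply: (@sub_finite_set _ _
    ((fun f1 : W -> C => fun w => f v / f1 v * f1 w) @` [set M_ h f | h in G])).
  move=> _ [h Ph <-]; exists (M_ h f); first by exists h => //; case: Ph.
  apply/funext => w; rewrite M_P_v // /chi_twist invfM; congr (_ * _).
  by rewrite mulrCA divff // mulr1.
exact/finite_image/(orbit_finite Vf).
Qed.

Lemma chi_twisted_orbit_sum v f (r : seq (W -> C)) h : uniq r ->
  (forall f1, f1 \in r <-> chi_twisted_orbit v f f1) -> P_v beta A B v h ->
  chi_twist v h (fun w => \sum_(f1 <- r) f1 w) = (fun w => \sum_(f1 <- r) f1 w).
Proof.
move=> ur r_orbit Ph; apply/funext => w; have [_ [Gh _]] := (Ph, Ph).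
have perm_r : perm_eq (map (chi_twist v h) r) r.
  have ut : uniq (map (chi_twist v h) r).
    by rewrite (map_inj_uniq (chi_twist_inj Ph)).
  apply: uniq_perm => //; apply: (uniq_min_size ut _ _).2;
    last by rewrite size_map.
  move=> _ /mapP [_ /r_orbit [g Pg <-] ->]; apply/r_orbit.
  by exists (h *m g); [exact: P_vM|exact: chi_twistM].
by rewrite -(perm_big _ perm_r) big_map /chi_twist /M_ big_distrr.
Qed.

(* Summing the twisted orbit of [f] under the stabilizer of [v + A] leaves,   *)
(* by separation, only the values on the cosets of [v] and [-v].              *)
Lemma isolate i s (F : set (W -> C)) f v :
  F `<=` parity_space i s -> fsubspace F ->
  rep_invariant G (@M_ R k n) F -> F f -> f v != 0 ->
  exists f0, [/\ F f0, f0 v != 0 & concentrated v f0].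
Proof.
move=> FV subF FM Ff fv; have Vf := FV _ Ff; have [[eqv_f _] _] := Vf.
have /finite_seqP [r0 r0P] := chi_twisted_orbit_finite Vf fv.
pose r := undup r0; have ur : uniq r by exact: undup_uniq.
have r_orbit f1 : f1 \in r <-> chi_twisted_orbit v f f1.
  by rewrite r0P /= mem_undup.
pose f0 w := \sum_(f1 <- r) f1 w.
have Ff0 : F f0.
  apply: (fsubspace_sum subF) => f1 /r_orbit [h [Gh _] <-].
  exact/(fsubspaceZ subF)/FM.
have [[eqv_f0 _] _] := FV _ Ff0; exists f0; split=> //.
  have -> : f0 v = \sum_(f1 <- r) f v.
    rewrite /f0 big_seq [RHS]big_seq; apply: eq_bigr => f1 /r_orbit [h Ph <-].
    exact: chi_twist_center.
  rewrite big_const_seq count_predT iter_addr_0 -mulr_natr mulf_neq0 //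
    pnatr_eq0.
  rewrite -lt0n -has_predT; apply/hasP; exists f => //; apply/r_orbit.
  by exists 1%:M; [exact: P_v1|exact: chi_twist1].
apply: twisted_concentrated => // h Ph w.
rewrite -{2}[f0](chi_twisted_orbit_sum ur r_orbit Ph) /chi_twist.
by rewrite mulVKf // chi_v_neq0.
Qed.

Lemma cancel_concentrated i s f f0 x w (a := f x / f0 x) :
  parity_space i s f -> parity_space i s f0 -> f0 x != 0 -> concentrated x f0 ->
  - a * f0 w + f w != 0 -> f w != 0 /\ ~ A (w - x).
Proof.
move=> Vf Vf0 f0x conc_f0; have [_ VD] := parity_space_fsubspace i s.
have [[eqv _] parity] := VD (- a) _ _ Vf0 Vf.
have cancel_x : - a * f0 x + f x = 0 by rewrite mulNr divfK // addNr.
move=> nz_w; have nAwx : ~ A (w - x).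
  by move=> /(equivariant_neq0 eqv) /(_ nz_w); rewrite cancel_x eqxx.
have nAwNx : ~ A (w + x).
  rewrite -[x]opprK => /(equivariant_neq0 eqv) /(_ nz_w).
  by rewrite parity cancel_x mulr0 eqxx.
split=> //; apply: contraNneq nz_w => ->.
by rewrite (concentrated_out conc_f0 nAwx nAwNx) mulr0 addr0.
Qed.

Lemma parity_space_generated i s (F : set (W -> C)) : fsubspace F ->
  F `<=` parity_space i s ->
  (forall x, level i x ->
    exists f0, [/\ F f0, f0 x != 0 & concentrated x f0]) ->
  parity_space i s `<=` F.
Proof.
move=> subF FV F_conc f Vf; have [_ openA _] := A_olattice.
have [r r_cover] := level_finite_cover i A_omodule openA.
have {r_cover} : forall w, f w != 0 -> exists2 x, x \in r & A (w - x).
  by move=> w fw; apply: r_cover; have [[_ supp_f] _] := Vf; exact: supp_f.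
elim: r f Vf => [|x r IH] f Vf f_cover.
  rewrite (_ : f = (fun=> 0)); first by have [] := subF.
  by apply/funext => w; have [//|/f_cover [x]] := eqVneq (f w) 0.
have [[eqv_f supp_f] _] := Vf; have [fx|fx] := eqVneq (f x) 0.
  apply: IH => // w fw; have [y + Awy] := f_cover w fw.
  rewrite inE => /orP [/eqP y_x|yr]; last by exists y.
  by rewrite y_x in Awy; have := equivariant_neq0 eqv_f Awy fw; rewrite fx eqxx.
have [f0 [Ff0 f0x conc_f0]] := F_conc x (supp_f x fx).
pose a := f x / f0 x.
have [_ FD] := subF.
have [_ VD] := parity_space_fsubspace i s.
have -> : f = (fun w => a * f0 w + (- a * f0 w + f w)).
  by apply/funext => w; rewrite mulNr addNKr.
apply: FD => //; apply: IH => [|w]; first by apply: VD => //; exact: FV.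
move=> /(cancel_concentrated Vf (FV _ Ff0) f0x conc_f0)
  [/f_cover [y + Awy] nAwx].
by rewrite inE => /orP [/eqP y_x|yr]; [rewrite y_x in Awy|exists y].
Qed.

Definition unitary_twist (act : 'M[k]_n -> (W -> C) -> (W -> C))
    (z : 'M[k]_n -> C) :=
  [/\ forall g f, G g -> H f -> act g f = (fun w => z g * M_ g f w),
      forall g, G g -> `|z g| = 1 &
      forall g h, G g -> G h -> z (g *m h) = z g * z h].

Section TwistedRepresentation.
Variables (act : 'M[k]_n -> (W -> C) -> (W -> C)) (z : 'M[k]_n -> C).
Hypothesis act_twist : unitary_twist act z.

Lemma unitary_twistE g f : G g -> H f -> act g f = (fun w => z g * M_ g f w).
Proof. by have [actE _ _] := act_twist; exact: actE. Qed.

Lemma unitary_twist_norm g : G g -> `|z g| = 1.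
Proof. by have [_ z_norm _] := act_twist; exact: z_norm. Qed.

Lemma unitary_twist_mul g h : G g -> G h -> z (g *m h) = z g * z h.
Proof. by have [_ _ zM] := act_twist; exact: zM. Qed.

Lemma unitary_twist_neq0 g : G g -> z g != 0.
Proof. by move=> Gg; rewrite -normr_eq0 unitary_twist_norm ?oner_neq0. Qed.

Definition parity_rep i s : hrep R 'M[k]_n :=
  @HRep R 'M[k]_n W (parity_space i s) (Hform A) act.

Lemma parity_space_invariant i s : rep_invariant G act (parity_space i s).
Proof.
move=> g f Gg Vf; rewrite unitary_twistE //; last exact: parity_space_Hspace Vf.
exact/(fsubspaceZ (parity_space_fsubspace i s))/parity_space_M.
Qed.

Lemma parity_rep_irreducible i s :
  nonzero_space (parity_space i s) -> rep_irreducible G (parity_rep i s).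
Proof.
move=> nzV; split=> // F FV subF _ F_act.
have FM : rep_invariant G (@M_ R k n) F.
  move=> g f Gg Ff; have := fsubspaceZ subF (z g)^-1 (F_act g f Gg Ff); congr F.
  rewrite /= unitary_twistE //; last exact: parity_space_Hspace (FV _ Ff).
  by apply/funext => w; rewrite mulKf ?unitary_twist_neq0.
have [[f [Ff /neq0_fun [v fv]]]|F0] :=
  pselect (exists f, F f /\ f <> (fun=> 0)).
  right; apply/seteqP; split=> //; apply: parity_space_generated => // x ix.
  have [f0 [Ff0 f0v conc_f0]] := isolate FV subF FM Ff fv.
  have [[_ supp_f] _] := FV _ Ff.
  have [g Gg Agv] := level_transitive (supp_f v fv) ix.
  exists (M_ g f0); split; [exact: FM| |exact: concentrated_M Agv conc_f0].
  have [[eqv _] _] := FV _ (FM g f0 Gg Ff0); apply: equivariant_neq0 eqv Agv _.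
  by rewrite /M_ mulKmx ?P_B_unit.
left; apply/seteqP; split=> [f Ff|_ ->]; last by have [] := subF.
by apply: contrapT => f0; apply: F0; exists f.
Qed.

Section Intertwiner.
Variables (i i' : nat) (s s' : bool) (T : (W -> C) -> (W -> C)).
Hypothesis T_linear : forall (a : C) (f g : W -> C),
  parity_space i s f -> parity_space i s g ->
  T (fun w => a * f w + g w) = (fun w => a * T f w + T g w).
Hypothesis T_in : forall f, parity_space i s f -> parity_space i' s' (T f).
Hypothesis T_act :
  forall g f, G g -> parity_space i s f -> T (act g f) = act g (T f).

Lemma intertwinerZ a f : parity_space i s f ->
  T (fun w => a * f w) = (fun w => a * T f w).
Proof.
have [V0 _] := parity_space_fsubspace i s.
have T0 : T (fun=> 0) = (fun=> 0).
  have := T_linear (-1) V0 V0; rewrite (_ : (fun w => _) = (fun=> 0));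
    last by apply/funext => w; rewrite mulr0 addr0.
  by move=> ->; apply/funext => w; rewrite mulN1r addNr.
move=> Vf; have := T_linear a Vf V0; rewrite T0.
by under eq_fun do rewrite addr0; move=> ->; apply/funext => w; rewrite addr0.
Qed.

Lemma intertwiner_eigen g (a : C) f : G g -> parity_space i s f ->
  M_ g f = (fun w => a * f w) -> M_ g (T f) = (fun w => a * T f w).
Proof.
move=> Gg Vf Mf; apply/funext => w; have := T_act Gg Vf.
rewrite !unitary_twistE ?Mf //; last 2 first.
- exact/parity_space_Hspace/T_in.
- exact: parity_space_Hspace Vf.
rewrite (_ : (fun w => z g * (a * f w)) = (fun w => z g * a * f w)); last first.
  by apply/funext => x; rewrite mulrA.
rewrite intertwinerZ // => /(congr1 (fun f1 => f1 w)) /=; rewrite -mulrA.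
by move=> /(mulfI (unitary_twist_neq0 Gg)).
Qed.

(* The image of [delta_pm v s] is again twisted by [chi_v], hence             *)
(* concentrated at [v]; its parity is read off the action of [-1].            *)
Lemma intertwiner_delta_pm v : level i v -> T (delta_pm v s) <> (fun=> 0) ->
  (i, s) = (i', s').
Proof.
move=> iv /neq0_fun [w Tw]; have Vd := delta_pm_in s iv.
have [[eqv_T supp_T] TN] := T_in Vd.
have conc_T : concentrated v (T (delta_pm v s)).
  apply: twisted_concentrated => // h Ph x; have [Gh _] := Ph.
  by rewrite (intertwiner_eigen Gh Vd (delta_pm_twisted s iv Ph)).
have iw : level i w.
  have [Awv|] := conc_T _ Tw; first exact/(level_eqA _ Awv).
  by rewrite -{1}[v]opprK => Awv; apply/(level_eqA _ Awv)/levelN.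
have MN1 : M_ (- 1%:M) (delta_pm v s) = (fun w => sgn R s * delta_pm v s w).
  by apply/funext => x; rewrite M_N1; have [_] := Vd.
have := congr1 (fun f => f w) (intertwiner_eigen (P_BN P_B1) Vd MN1).
rewrite /= M_N1 TN => /(mulIf Tw) /sgn_inj ->.
by rewrite (level_inj iw (supp_T w Tw)).
Qed.

End Intertwiner.

Lemma parity_rep_inequivalent i s i' s' v : level i v -> (A v -> s = true) ->
  (i, s) <> (i', s') -> ~ rep_equivalent G (parity_rep i s) (parity_rep i' s').
Proof.
move=> iv center_v ne [T [T_lin T_iso T_im T_act]]; have Vd := delta_pm_in s iv.
have T_in f : parity_space i s f -> parity_space i' s' (T f).
  by move=> Vf; rewrite -[parity_space i' s']T_im; exists f.
have Td0 : T (delta_pm v s) = (fun=> 0).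
  by apply: contrapT => /(intertwiner_delta_pm T_lin T_in T_act iv).
have := T_iso _ _ Vd Vd; rewrite Td0 /= /Hform l2_form_disjoint; last by left.
have [t tA Atv] := cosets_ex v; have [[eqv _] _] := Vd.
have [_ sum_d] := parity_space_Hspace Vd.
move=> /esym/eqP; apply/negP; apply: l2_form_neq0 sum_d tA _.
apply: (equivariant_neq0 eqv _ (delta_pm_neq0 center_v)).
exact/(omodule_subC A_omodule).
Qed.

End TwistedRepresentation.

(** * Induced representations *)

Section Induced.
Variables (i : nat) (v : W).
Hypotheses (i_gt0 : (0 < i)%N) (iv : level i v).
Local Notation Pt := (Ptilde_v beta A B v).
Local Notation chi := (chi_pm psi beta A B v).
Local Notation LC := (left_cosets G Pt).

Let nAv : ~ A v. Proof. exact: level_gt0_notA iv. Qed.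

Lemma Ptilde_subgroup : matrix_subgroup Pt.
Proof. exact/matrix_subgroup_pm/P_v_subgroup. Qed.

Lemma PtildeE g : Pt g <-> G g /\ (A (g *m v - v) \/ A (g *m v + v)).
Proof.
have P_v_opp : P_v beta A B v (- g) <-> G g /\ A (g *m v + v).
  rewrite /P_v /= mulNmx -opprD (omoduleN A_omodule).
  by split=> -[/P_BN Gg Ag]; split=> //; rewrite -(opprK g).
rewrite /Ptilde_v /= P_v_opp; split=> [[[Gg Ag]|[Gg Ag]]|[Gg [Ag|Ag]]].
- by split=> //; left.
- by split=> //; right.
- by left.
- by right.
Qed.

Lemma Ptilde_sub : Pt `<=` G. Proof. by move=> g /PtildeE []. Qed.

Lemma Ptilde_coset x y : G x -> G y ->
  Pt (invmx x *m y) <-> A (y *m v - x *m v) \/ A (y *m v + x *m v).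
Proof.
move=> Gx Gy; have Gxy : G (invmx x *m y) by apply: P_BM => //; exact: P_BV.
rewrite PtildeE -(P_B_A (invmx x *m y *m v - v) Gx).
rewrite -(P_B_A (invmx x *m y *m v + v) Gx) mulmxBr mulmxDr -mulmxA.
by rewrite (mulKVmx (P_B_unit Gx)); split=> [[]|].
Qed.

Lemma Ptilde_cosets_sub : LC `<=` G.
Proof. exact: left_cosets_sub P_B_subgroup Ptilde_subgroup. Qed.

Lemma Ptilde_cosets_ex x : G x ->
  exists2 t, LC t & A (x *m v - t *m v) \/ A (x *m v + t *m v).
Proof.
move=> Gx; have [t tL tx] := left_cosets_ex P_B_subgroup Ptilde_subgroup Gx.
by exists t => //; apply/Ptilde_coset => //; exact: Ptilde_cosets_sub.
Qed.

Lemma Ptilde_cosets_inj x y : LC x -> LC y ->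
  A (x *m v - y *m v) \/ A (x *m v + y *m v) -> x = y.
Proof.
move=> xL yL Axy; apply/esym.
apply: (left_cosets_inj P_B_subgroup Ptilde_subgroup yL xL).
by apply/Ptilde_coset => //; exact: Ptilde_cosets_sub.
Qed.

Lemma Ptilde_cosets_finite :
  exists2 r : seq 'M[k]_n, uniq r & forall x, x \in r <-> LC x.
Proof.
have [_ openA _] := A_olattice.
have [r r_cover] := level_finite_cover i A_omodule openA.
pose b w := xget 0 [set x | LC x /\ A (x *m v - w)].
have /finite_seqP [q LC_q] : finite_set LC.
  apply: (@sub_finite_set _ _ (b @` [set` r]));
    last exact/finite_image/finite_seq.
  move=> x xL; have /r_cover [w wr Axw] : level i (x *m v).
    by apply/P_B_level => //; exact: Ptilde_cosets_sub.
  have [bL Abw] : LC (b w) /\ A (b w *m v - w).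
    by apply: (@xgetPex _ 0 [set x | LC x /\ A (x *m v - w)]); exists x.
  exists w => //; apply: Ptilde_cosets_inj => //; left.
  by apply: (omodule_sub_trans A_omodule) Abw _; exact/(omodule_subC A_omodule).
by exists (undup q); [exact: undup_uniq|move=> x; rewrite mem_undup LC_q].
Qed.

Lemma parity_space_Ptilde s f x h : parity_space i s f -> G x -> Pt h ->
  f (x *m (h *m v)) = (chi s h)^-1 * f (x *m v).
Proof.
move=> [[eqv_f _] fN] Gx Pt_h; rewrite /chi_pm; case: asboolP => Ph.
  exact: equivariant_P_v.
have {Pt_h}Ph : P_v beta A B v (- h) by case: Pt_h.
have -> : x *m (h *m v) = - (x *m (- h *m v)) by rewrite mulNmx mulmxN opprK.
by rewrite fN equivariant_P_v // invfM sgnV mulrA.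
Qed.

Lemma chi_pm_norm s g : `|chi s g| = 1.
Proof.
rewrite /chi_pm /chi_v; case: ifP => _; rewrite ?normrM psi_norm //.
by case: s; rewrite /= ?normrN normr1 mulr1.
Qed.

Lemma chi_pmM s g h : Pt g -> Pt h -> chi s (g *m h) = chi s g * chi s h.
Proof.
move=> Pg Ph; have Vd := delta_pm_in s iv; have [_ PM _] := Ptilde_subgroup.
have delta_1 : delta_pm v s (1%:M *m v) = 1 by rewrite mul1mx delta_pm_center.
apply: invr_inj; rewrite invfM mulrC.
have := parity_space_Ptilde Vd P_B1 (PM _ _ Pg Ph).
rewrite delta_1 mulr1 => <-; rewrite mul1mx -mulmxA.
rewrite (parity_space_Ptilde Vd (Ptilde_sub Pg) Ph) -[g *m v]mul1mx.
by rewrite (parity_space_Ptilde Vd P_B1 Pg) delta_1 mulr1.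
Qed.

Section Equivalence.
Variables (act : 'M[k]_n -> (W -> C) -> (W -> C)) (z : 'M[k]_n -> C).
Hypothesis act_twist : unitary_twist act z.
Variable s : bool.
Local Notation Ind_rep := (Ind G Pt (fun g => z g * chi s g)).

(* [sqrt 2] compensates for the two cosets [x v + A] and [- x v + A] of W / A *)
(* lying over each coset of [Pt].                                             *)
Definition orbit_function f : 'M[k]_n -> C :=
  fun x => if `[< G x >] then sqrtC 2 * (z x)^-1 * f (x *m v) else 0.

Lemma orbit_function_in f : parity_space i s f ->
  rep_space Ind_rep (orbit_function f).
Proof.
move=> Vf; split=> [g nGg|g h Gg Pt_h|]; rewrite /orbit_function.
- by rewrite asboolF.
- have Gh := Ptilde_sub Pt_h; rewrite !asboolT //; last exact: P_BM.
  by rewrite -mulmxA (parity_space_Ptilde Vf) //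
    (unitary_twist_mul act_twist) // !invfM; ring.
- have [r _ rLC] := Ptilde_cosets_finite.
  apply: (@square_summable_seq _ _ _ r) => x xL _.
  exact/rLC.
Qed.

Lemma level_coset_seq (r : seq 'M[k]_n)
    (r2 := [seq x *m v | x <- r] ++ [seq - (x *m v) | x <- r]) :
  uniq r -> (forall x, x \in r <-> LC x) ->
  [/\ uniq r2, forall w w', w \in r2 -> w' \in r2 -> A (w - w') -> w = w' &
      forall w, level i w -> exists2 x, x \in r2 & A (x - w)].
Proof.
move=> ur rLC; have rG x : x \in r -> G x by move=> /rLC /Ptilde_cosets_sub.
have same x y : x \in r -> y \in r ->
    A (x *m v - y *m v) \/ A (x *m v + y *m v) -> x = y.
  by move=> /rLC xL /rLC yL; exact: Ptilde_cosets_inj.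
have opposite x y : x \in r -> y \in r -> ~ A (x *m v + y *m v).
  move=> xr yr Axy; have eq_xy : x = y by apply: same => //; right.
  by apply/nAv/A_of_double; rewrite -(P_B_A _ (rG y yr)) mulmxDr -{1}eq_xy.
have r2_inj w w' : w \in r2 -> w' \in r2 -> A (w - w') -> w = w'.
  rewrite !mem_cat => /orP [] /mapP [x xr ->] /orP [] /mapP [y yr ->].
  - by move=> Axy; rewrite (same x y) //; left.
  - by rewrite opprK => /(opposite x y xr yr).
  - by rewrite -opprD (omoduleN A_omodule) => /(opposite x y xr yr).
  - by rewrite -opprD (omoduleN A_omodule) => Axy; rewrite (same x y) //; left.
split=> // [|w iw].
- have injv x y : x \in r -> y \in r -> x *m v = y *m v -> x = y.
    by move=> xr yr eq_v; apply: same => //; left; rewrite eq_v subrr;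
      exact: omodule0 A_omodule.
  rewrite cat_uniq !map_inj_in_uniq ?ur ?andbT /=; last exact: injv.
    apply/hasPn => _ /mapP [y yr ->]; apply/mapP => -[x xr /eqP].
    rewrite -subr_eq0 -opprD oppr_eq0 => /eqP Axy; apply: (opposite y x) => //.
    by rewrite Axy; exact: omodule0 A_omodule.
  by move=> x y xr yr /oppr_inj; exact: injv.
- have [g Gg Agv] := level_transitive iv iw.
  have [x xL Ax] := Ptilde_cosets_ex Gg.
  have xr : x \in r by apply/rLC.
  case: Ax => Ax.
    exists (x *m v);
      first by rewrite mem_cat; apply/orP; left; apply/mapP; exists x.
    by apply: (omodule_sub_trans A_omodule) Agv; exact/(omodule_subC A_omodule).
  exists (- (x *m v));
    first by rewrite mem_cat; apply/orP; right; apply/mapP; exists x.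
  have := omoduleB A_omodule Agv Ax.
  by rewrite opprD addrACA subrr add0r addrC.
Qed.

Lemma orbit_function_isometry f f' :
  parity_space i s f -> parity_space i s f' ->
  l2_form LC (orbit_function f) (orbit_function f') = Hform A f f'.
Proof.
move=> [[eqv_f supp_f] fN] [[eqv_f' _] f'N].
have [r ur rLC] := Ptilde_cosets_finite.
have [ur2 r2_inj r2_cover] := level_coset_seq ur rLC.
rewrite (Hform_seq eqv_f eqv_f' ur2 r2_inj); last by move=> w /supp_f /r2_cover.
rewrite /l2_form (complex_sum_seq ur); last 2 first.
- by move=> x /rLC.
- by move=> x xL _; apply/rLC.
rewrite big_cat /= !big_map -big_split /= big_seq [RHS]big_seq.
apply: eq_bigr => x xr; have Gx : G x by apply/Ptilde_cosets_sub/rLC.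
rewrite /orbit_function asboolT // fN f'N !rmorphM /=.
have c2 : sqrtC 2 * (sqrtC 2)^* = 2 :> C.
  by rewrite conj_Creal ?sqrtC_real ?ler0n // -expr2 sqrtCK.
have z2 : (z x)^-1 * ((z x)^-1)^* = 1.
  by rewrite -normCK normfV (unitary_twist_norm act_twist) // invr1 expr1n.
have s2 : sgn R s * (sgn R s)^* = 1.
  by rewrite conj_Creal ?sgnM //; case: (s); rewrite /= ?rpredN rpred1.
transitivity (sqrtC 2 * (sqrtC 2)^* * ((z x)^-1 * ((z x)^-1)^*)
    * (f (x *m v) * (f' (x *m v))^*)); first by ring.
rewrite c2 z2 mulr1 mulr2n mulrDl mul1r; congr (_ + _).
by rewrite mulrACA s2 mul1r.
Qed.

Lemma orbit_function_surj (Phi : 'M[k]_n -> C) : rep_space Ind_rep Phi ->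
  exists2 f, parity_space i s f & orbit_function f = Phi.
Proof.
move=> Ind_Phi; have [r ur rLC] := Ptilde_cosets_finite.
pose a x := (sqrtC 2)^-1 * z x * Phi x.
pose f w := \sum_(x <- r) a x * delta_pm (x *m v) s w.
have lev x : LC x -> level i (x *m v).
  by move=> /Ptilde_cosets_sub Gx; exact/P_B_level.
have Vf : parity_space i s f.
  apply: (fsubspace_sum (parity_space_fsubspace i s)) => x /rLC xL.
  exact/(fsubspaceZ (parity_space_fsubspace i s))/delta_pm_in/lev.
exists f => //; apply: (Ind_ext P_B_subgroup Ptilde_subgroup) Ind_Phi _.
  exact: orbit_function_in.
move=> t tL; have tr : t \in r by apply/rLC.
have Gt := Ptilde_cosets_sub tL.
rewrite /orbit_function asboolT // /f (bigD1_seq t) //=.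
rewrite delta_pm_center; last by apply: level_gt0_notA (lev t tL).
rewrite big_seq_cond big1 => [|x /andP [/rLC xL x_t]]; last first.
  have /not_orP [nA nA'] : ~ (A (t *m v - x *m v) \/ A (t *m v + x *m v)).
    by move=> /(Ptilde_cosets_inj tL xL) t_x; rewrite t_x eqxx in x_t.
  by rewrite (concentrated_out (@delta_pm_concentrated _ s) nA nA') mulr0.
rewrite addr0 mulr1 /a.
have c0 : sqrtC 2 != 0 :> C by rewrite sqrtC_eq0 pnatr_eq0.
by field; rewrite (unitary_twist_neq0 act_twist) // c0.
Qed.

Lemma parity_rep_Ind : rep_equivalent G (parity_rep act i s) Ind_rep.
Proof.
exists orbit_function; split=> [a f g _ _|f g|| g f Gg Vf].
- apply/funext => x; rewrite /orbit_function.
  by case: asboolP => _; [ring|rewrite mulr0 addr0].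
- exact: orbit_function_isometry.
- apply/seteqP; split=> [_ [f Vf <-]|Phi /orbit_function_surj [f Vf <-]].
    exact: orbit_function_in.
  by exists f.
- apply/funext => x; rewrite /= /orbit_function (unitary_twistE act_twist) //;
    last exact: parity_space_Hspace Vf.
  have ug := P_B_unit Gg; have GgV := P_BV Gg.
  have [Gx|nGx] := pselect (G x); last first.
    rewrite !asboolF // => Ggx; apply: nGx.
    by rewrite -(mulKVmx ug x); exact: P_BM.
  have Ggx : G (invmx g *m x) by exact: P_BM.
  have zx : z x = z g * z (invmx g *m x).
    by rewrite -(unitary_twist_mul act_twist) // mulKVmx.
  rewrite !asboolT // /M_ mulmxA zx.
  by field; rewrite !(unitary_twist_neq0 act_twist).
Qed.

End Equivalence.

Lemma Ptilde_locally_constant :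
  exists N : int, forall g g' : 'M[k]_n, ball_mx N (g' - g) ->
  A (g' *m v - g *m v) /\ ideal lambda (2^-1 * beta (g' *m v - g *m v) v).
Proof.
have [N NA] := periods_ball i; have [M Mv] := ball_mx_exhaust v.
exists (N - M) => g g' Ngg.
have Kgg : periods i (g' *m v - g *m v).
  by apply: NA; rewrite -mulmxBl -(subrK M N); exact: ball_mxM.
split; first exact: periods_A Kgg.
by rewrite betaC mulrN; apply: idealN; exact: beta_periods iv Kgg.
Qed.

Lemma Ptilde_open : exists2 U : set 'M[k]_n, open U & Pt = G `&` U.
Proof.
have [N near_A] := Ptilde_locally_constant.
exists [set g | A (g *m v - v) \/ A (g *m v + v)]; last first.
  by apply/seteqP; split=> g; [move=> /PtildeE|move=> ?; apply/PtildeE].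
rewrite openE => g Ag; apply/nbhs_ball_mx; exists N => g' /near_A [Agg _].
case: Ag => Ag; [left|right]; first exact: (omodule_sub_trans A_omodule) Ag.
by have := omoduleD A_omodule Agg Ag; rewrite addrA subrK.
Qed.

Lemma chi_pm_continuous s : {within Pt, continuous (chi s : 'M[k]_n -> C^o)}.
Proof.
have [N near_A] := Ptilde_locally_constant.
have chi_near g g' : Pt g -> Pt g' -> ball_mx N (g' - g) -> chi s g' = chi s g.
  move=> /Ptilde_sub Gg /Ptilde_sub Gg' /near_A [Agg lambda_gg].
  have chi_v_near : chi_v psi beta v g' = chi_v psi beta v g.
    by apply: psi_congr; rewrite -mulrBr -betaNl -betaDl.
  have chi_v_nearN : chi_v psi beta v (- g') = chi_v psi beta v (- g).
    by move: chi_v_near; rewrite /chi_v !mulNmx !betaE !mulrN !psiN => ->.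
  rewrite /chi_pm chi_v_near chi_v_nearN.
  have -> // : `[< P_v beta A B v g' >] = `[< P_v beta A B v g >].
  apply/asboolP/asboolP => -[_ Ag]; split=> //.
    by apply: (omodule_sub_trans A_omodule) Ag; exact/(omodule_subC A_omodule).
  exact: (omodule_sub_trans A_omodule) Ag.
apply/subspace_continuousP => g Pg U /nbhs_singleton Ug.
apply/nbhs_ball_mx; exists N => g' Ngg Pg'.
by change (U (chi s g')); rewrite (chi_near g g').
Qed.

Lemma chi_pm_character s : group_character Pt (chi s).
Proof.
by split;
  [exact: chi_pmM|move=> g _; exact: chi_pm_norm|exact: chi_pm_continuous].
Qed.

End Induced.

(** * Level zero *)

Lemma level_space0P f :
  level_space 0 f <-> exists a : C, f = (fun w => a * delta0 R A w).
Proof.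
split=> [Vf|[a ->]].
  have [eqv_f _] := Vf; exists (f 0); apply/funext => w; rewrite /delta0.
  have [Aw|nAw] := pselect (A w); last first.
    by rewrite memNset // mulr0; apply: (level_space_out Vf); rewrite level0.
  rewrite mem_set // mulr1; have Aw0 : A (w - 0) by rewrite subr0.
  by rewrite (equivariant_congr eqv_f Aw0) beta0l mulr0 psi0 mul1r.
split=> [b w Ab|w]; rewrite /delta0.
  have -> : (b + w \in A) = (w \in A).
    by apply/idP/idP; rewrite !inE => /(omoduleDl A_omodule _ Ab).
  have [Aw|nAw] := pselect (A w); last by rewrite memNset // !mulr0.
  by rewrite psi_ideal ?mul1r //; apply: ideal_half => //; exact: beta_AA.
rewrite level0; have [//|nAw] := pselect (A w).
by rewrite memNset // mulr0 eqxx.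
Qed.

Lemma parity_space0E : parity_space 0 true = level_space 0.
Proof.
apply/seteqP; split=> [f []//|f Vf]; split=> // w.
have [a ->] := (level_space0P f).1 Vf; rewrite mul1r /delta0.
congr (a * (nat_of_bool _)%:R).
by apply/idP/idP; rewrite !inE (omoduleN A_omodule).
Qed.

Lemma delta0_in : level_space 0 (delta0 R A).
Proof. by apply/level_space0P; exists 1; apply/funext => w; rewrite mul1r. Qed.

Lemma delta0_0 : delta0 R A 0 = 1.
Proof. by rewrite /delta0 mem_set //; exact: (omodule0 A_omodule). Qed.

Lemma Hform_level0 f f' : level_space 0 f -> level_space 0 f' ->
  Hform A f f' = f 0 * (f' 0)^*.
Proof.
move=> [eqv_f supp_f] [eqv_f' _].
rewrite (Hform_seq eqv_f eqv_f' (r := [:: 0])).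
- by rewrite big_seq1.
- by [].
- by move=> v w; rewrite !inE => /eqP -> /eqP ->.
- move=> w /supp_f; rewrite level0 => Aw; exists 0; first exact: mem_head.
  by rewrite sub0r; exact/(omoduleN A_omodule).
Qed.

Lemma P_B_delta0 g : G g -> M_ g (delta0 R A) = delta0 R A.
Proof.
move=> /P_BV Gg; apply/funext => w; rewrite /M_ /delta0.
by congr (nat_of_bool _)%:R; apply/idP/idP; rewrite !inE (P_B_A _ Gg).
Qed.

Lemma parity_rep_level0 act z : unitary_twist act z ->
  rep_equivalent G (parity_rep act 0 true) (one_dim_rep z).
Proof.
move=> act_twist; exists (fun f _ => f 0); split=> /=.
- by [].
- by rewrite parity_space0E => f f' Vf Vf'; rewrite Hform_level0.
- rewrite parity_space0E; apply/seteqP; split=> // x _.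
  exists (fun w => x tt * delta0 R A w);
    first by apply/level_space0P; exists (x tt).
  by apply/funext => -[]; rewrite delta0_0 mulr1.
- move=> g f Gg Vf.
  rewrite (unitary_twistE act_twist) //; last exact: parity_space_Hspace Vf.
  by apply/funext => _; rewrite /M_ mulmx0.
Qed.

(** * The two representations of P_B *)

Lemma unitary_twist_M : unitary_twist (@M_ R k n) (fun=> 1).
Proof.
split=> [g f _ _|g _|g h _ _]; [|exact: normr1|by rewrite mulr1].
by apply/funext => w; rewrite mul1r.
Qed.

(* The character is read off [delta0], which spans a line stable under P_B;   *)
(* unitarity of the operators gives its absolute value.                       *)
Lemma unitary_twist_weil S : weil_lift psi beta A B S ->
  unitary_twist S (zeta R A B).
Proof.
move=> [metaS SM SE]; have Hd := level_space_Hspace delta0_in.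
have Gstab g : G g -> stab beta B g by case.
have S_delta0 g : G g ->
    S g (delta0 R A) = (fun w => zeta R A B g * delta0 R A w).
  by move=> Gg; rewrite SE // P_B_delta0.
have Vz g : level_space 0 (fun w => zeta R A B g * delta0 R A w).
  by apply/level_space0P; exists (zeta R A B g).
split=> [||g h Gg Gh]; first exact: SE.
  move=> g Gg; have [_ [_ S_iso _] _] := metaS g (Gstab g Gg).
  have := S_iso _ _ Hd Hd; rewrite S_delta0 // (Hform_level0 (Vz g) (Vz g)).
  rewrite (Hform_level0 delta0_in delta0_in) delta0_0 mulr1 -!normCK normr1
    expr1n.
  by move=> /eqP; rewrite sqrp_eq1 ?normr_ge0 // => /eqP.
have := SM g h _ (Gstab g Gg) (Gstab h Gh) Hd.
rewrite !S_delta0 ?SE //; [|exact: level_space_Hspace (Vz h)|exact: P_BM].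
by move=> /(congr1 (fun f => f 0)); rewrite /M_ mulmx0 delta0_0 !mulr1.
Qed.

Lemma parity_rep_monomial i s : nonzero_space (parity_space i s) ->
  (i = 0%N -> s = true) -> rep_monomial G (parity_rep (@M_ R k n) i s).
Proof.
move=> [f [[_ supp_f] _] /neq0_fun [v /supp_f iv]]; have [->|i_gt0] := posnP i.
  move=> ->//; apply: one_dim_monomial (parity_rep_level0 unitary_twist_M).
    exact: P_B_subgroup.
  split=> [g h _ _|g _|]; [by rewrite mulr1|exact: normr1|].
  by apply: continuous_subspaceT => x; exact: cst_continuous.
move=> _; exists (Ptilde_v beta A B v), (chi_pm psi beta A B v s); split.
- exact: Ptilde_subgroup.
- by split; [exact: Ptilde_sub|exact: Ptilde_open iv].
- exact: chi_pm_character i_gt0 iv s.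
- have := parity_rep_Ind i_gt0 iv unitary_twist_M s;
    congr (rep_equivalent G _ (Ind G _ _)).
  by apply/funext => g; rewrite mul1r.
Qed.

Lemma parity_space_nonzero i s : (0 < i)%N ->
  nonzero_space (parity_space i s) <-> exists w, level i w.
Proof.
move=> i_gt0; split=> [[f [[_ supp_f] _] /neq0_fun [v /supp_f iv]]|[v iv]].
  by exists v.
exists (delta_pm v s); first exact: delta_pm_in.
move=> /(congr1 (fun f => f v)); rewrite delta_pm_center;
  last exact: level_gt0_notA iv.
by move/eqP; rewrite oner_eq0.
Qed.

(** * The Hilbert sum *)

Lemma level_space_closed i : form_closed (Hform A) H (level_space i).
Proof.
move=> f [eqv_f sum_f] f_lim; split=> // w fw; apply: contrapT => niw.
have [t tA Atw] := cosets_ex w.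
have Awt : A (w - t) by exact/(omodule_subC A_omodule).
have ft : 0 < sqnorm (f t).
  by rewrite sqnorm_gt0; exact: equivariant_neq0 eqv_f Awt fw.
have [g Vg dist_g] := f_lim _ ft; have [_ sum_g] := level_space_Hspace Vg.
have gt0 : g t = 0 by apply: (level_space_out Vg); rewrite (level_eqA _ Atw).
by have := sqnorm_le_dist2 sum_f sum_g tA; rewrite gt0 subr0 leNgt dist_g.
Qed.

Lemma level_space_orthogonal i j f f' : i <> j ->
  level_space i f -> level_space j f' -> Hform A f f' = 0.
Proof.
move=> ij [_ supp_f] Vf'; apply: l2_form_disjoint => w _.
have [fw|/supp_f iw] := eqVneq (f w) 0; [by left|right].
by apply: (level_space_out Vf') => jw; apply/ij/(level_inj iw jw).
Qed.

Definition level_part i f w : C := if `[< level i w >] then f w else 0.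

Lemma level_part_in i f : equivariant f -> level_space i (level_part i f).
Proof.
move=> eqv_f; split=> [a w Aa|w]; rewrite /level_part; last first.
  by case: asboolP; rewrite ?eqxx.
have -> : `[< level i (a + w) >] = `[< level i w >].
  by apply/asboolP/asboolP; rewrite (level_eqA _ (_ : A (a + w - w))) ?addrK.
by case: ifP; rewrite ?mulr0 // eqv_f.
Qed.

Lemma level_parts_dense f (e : R) : H f -> 0 < e -> exists s : seq nat,
  dist2 (Hform A) f (fun w => \sum_(i <- s) level_part i f w) < e.
Proof.
move=> [_ sum_f] e0; pose lev w := projT1 (cid (level_ex w)).
have levP w : level (lev w) w by exact: (projT2 (cid (level_ex w))).
have [s us s_dense] := dist2_fibres lev sum_f e0; exists s.
move: s_dense; congr (dist2 _ _ _ < _); apply/funext => w.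
have partE i : level_part i f w = if i == lev w then f w else 0.
  rewrite /level_part; congr (if _ then _ else _).
  by apply/asboolP/eqP => [iw|->//]; exact: level_inj iw (levP w).
under eq_bigr do rewrite partE.
rewrite -big_mkcond /=; case: ifPn => lev_s; last first.
  by rewrite big1_seq // => i /andP [/eqP ->]; rewrite (negPf lev_s).
by rewrite -big_filter filter_pred1_uniq // big_seq1.
Qed.

(** * The labelled subspaces and representations *)

Lemma E_level_space m j :
  E_ varpi lambda psi beta A B m j = level_space (rank m j).
Proof.
have [rank0|rank_gt0] := posnP (rank m j).
  have [-> ->] : m = 0%N /\ j = j0.
    by move: rank0; rewrite /rank; case: j; split=> //; lia.
  by apply/seteqP; split=> f /level_space0P.
have -> : E_ varpi lambda psi beta A B m j =
    [set f | H f /\ forall w, f w != 0 -> layer varpi lambda beta A B m j w].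
  by case: m j rank_gt0 => [|m] [].
rewrite layerE //; apply/seteqP; split=> f; first by move=> [[]].
by move=> Vf; split; [exact: level_space_Hspace Vf|case: Vf].
Qed.

Lemma hilbert_sum_E : hilbert_sum (Hform A) H
  (fun mj : nat * layer_index => E_ varpi lambda psi beta A B mj.1 mj.2).
Proof.
split=> [[m j]|[m j] [m' j'] ne f f'|f Hf e e0] /=.
- rewrite E_level_space; split; first exact: level_space_Hspace.
    exact: level_space_fsubspace.
  exact: level_space_closed.
- rewrite !E_level_space; apply: level_space_orthogonal.
  by move=> /rank_inj [m_m' j_j']; apply: ne; rewrite m_m' j_j'.
- pose unrank i := projT1 (cid (rank_surj i)).
  have unrankK i : rank (unrank i).1 (unrank i).2 = i.
    exact: (projT2 (cid (rank_surj i))).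
  have [s s_dense] := level_parts_dense Hf e0.
  exists (map unrank s), (fun mj => level_part (rank mj.1 mj.2) f); split.
    by move=> mj; rewrite E_level_space; apply: level_part_in; case: Hf.
  by under eq_fun do (rewrite big_map; under eq_bigr do rewrite unrankK).
Qed.

Lemma nonzero_E00 : nonzero_space (E_ varpi lambda psi beta A B 0 j0).
Proof.
exists (delta0 R A); first by rewrite E_level_space; exact: delta0_in.
by move=> /(congr1 (fun f => f 0)) /eqP; rewrite delta0_0 oner_eq0.
Qed.

Local Notation V := (label_space varpi lambda psi beta A B).

Definition label_rank (x : label) : nat :=
  if x is Lpm m j _ then rank m j else 0.

Definition label_sgn (x : label) : bool := if x is Lpm _ _ s then s else true.

Lemma label_rank_gt0 m j s : valid_label (Lpm m j s) -> (0 < rank m j)%N.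
Proof. by rewrite /rank; case: j => //= m_gt0; lia. Qed.

Lemma label_rank_inj x y : valid_label x -> valid_label y ->
  (label_rank x, label_sgn x) = (label_rank y, label_sgn y) -> x = y.
Proof.
case: x y => [|m j s] [|m' j' s'] // vx vy [].
- by move=> rank0; have := label_rank_gt0 vy; rewrite -rank0.
- by move=> rank0; have := label_rank_gt0 vx; rewrite rank0.
- by move=> /rank_inj [-> ->] ->.
Qed.

Lemma label_spaceE x : V x = parity_space (label_rank x) (label_sgn x).
Proof.
case: x => [|m j s] /=; first by rewrite parity_space0E -(E_level_space 0 j0).
by rewrite /Epm E_level_space.
Qed.

Lemma subrepE act x :
  subrep varpi lambda psi beta A B act x =
    parity_rep act (label_rank x) (label_sgn x).
Proof. by rewrite /subrep label_spaceE. Qed.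

Lemma nonzero_Epm l m j s : quot_dim Bs B (2 * l) -> (0 < rank m j)%N ->
  nonzero_space (Epm varpi lambda psi beta A B m j s) <->
  if j is j1 then (2 * l < n)%N else (0 < l)%N.
Proof.
move=> dim_l rank_gt0.
rewrite [Epm _ _ _ _ _ _ _ _ _](label_spaceE (Lpm m j s)).
rewrite parity_space_nonzero //; case: j rank_gt0 => [|_|_].
- by case: m => // m _; exact: level_j0_nonempty.
- exact: level_j1_nonempty.
- exact: level_j2_nonempty.
Qed.

Lemma label_M_monomial x : valid_label x -> nonzero_space (V x) ->
  rep_monomial G (subrep varpi lambda psi beta A B (@M_ R k n) x).
Proof.
move=> vx; rewrite subrepE label_spaceE => /parity_rep_monomial; apply.
by case: x vx => // m j s /label_rank_gt0 rank_gt0 /= rank0;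
  rewrite rank0 in rank_gt0.
Qed.

Section LabelledRepresentations.
Variables (act : 'M[k]_n -> (W -> C) -> (W -> C)) (z : 'M[k]_n -> C).
Hypothesis act_twist : unitary_twist act z.
Local Notation rep := (subrep varpi lambda psi beta A B act).

Lemma label_rep_irreducible x : nonzero_space (V x) ->
  rep_invariant G act (V x) /\ rep_irreducible G (rep x).
Proof.
rewrite subrepE label_spaceE => nzV; split.
  exact: (parity_space_invariant act_twist).
exact: (parity_rep_irreducible act_twist nzV).
Qed.

Lemma label_rep_inequivalent x y : valid_label x -> valid_label y ->
  nonzero_space (V x) -> x <> y -> ~ rep_equivalent G (rep x) (rep y).
Proof.
move=> vx vy; rewrite label_spaceE !subrepE => -[f [[_ supp_f] _]].
move=> /neq0_fun [v /supp_f xv] x_y.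
apply: (parity_rep_inequivalent act_twist xv)
  => [Av|/(label_rank_inj vx vy) //].
case: x vx xv {supp_f x_y} => // m j s /label_rank_gt0 rank_gt0.
by move=> /(level_gt0_notA rank_gt0).
Qed.

Lemma label_rep_L00 : rep_equivalent G (rep L00) (one_dim_rep z).
Proof. by rewrite subrepE; exact: parity_rep_level0. Qed.

Lemma label_rep_Ind m j s v : valid_label (Lpm m j s) ->
  layer varpi lambda beta A B m j v ->
  rep_equivalent G (rep (Lpm m j s))
    (Ind G (Ptilde_v beta A B v) (fun g => z g * chi_pm psi beta A B v s g)).
Proof.
by move=> /label_rank_gt0 rank_gt0; rewrite layerE // subrepE => iv;
  exact: parity_rep_Ind.
Qed.

End LabelledRepresentations.

Lemma unitary_twist_decomposition act z
    (rep := subrep varpi lambda psi beta A B act) :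
  unitary_twist act z ->
  [/\ forall x, valid_label x -> nonzero_space (V x) ->
        rep_invariant G act (V x) /\ rep_irreducible G (rep x),
      forall x y, valid_label x -> valid_label y ->
        nonzero_space (V x) -> nonzero_space (V y) -> x <> y ->
        ~ rep_equivalent G (rep x) (rep y),
      rep_equivalent G (rep L00) (one_dim_rep z) &
      forall (m : nat) (j : layer_index) (s : bool) v,
        valid_label (Lpm m j s) -> layer varpi lambda beta A B m j v ->
        rep_equivalent G (rep (Lpm m j s))
          (Ind G (Ptilde_v beta A B v)
            (fun g => z g * chi_pm psi beta A B v s g))].
Proof.
move=> act_twist; split.
- by move=> x _; exact: label_rep_irreducible act_twist x.
- by move=> x y vx vy nz _; exact: (label_rep_inequivalent act_twist vx vy nz).
- exact: label_rep_L00.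
- by move=> m j s v; exact: label_rep_Ind.
Qed.

End LatticeModel.

Theorem mainTheorem6 (R : realType) (k : naLocalFieldType) (r l : nat)
    (varpi : k) (lambda : int) (psi : k -> R[i])
    (beta : 'cV[k]_(2 * r) -> 'cV[k]_(2 * r) -> k)
    (A B : set 'cV[k]_(2 * r))
    (char_k : [pchar k] =i pred0)
    (char_res : 2%N \notin [pchar (residue k)])
    (varpi_unif : uniformizer varpi)
    (psi_char : unitary_character psi)
    (psi_cond : has_conductor varpi psi lambda)
    (r_gt0 : (0 < r)%N)
    (beta_sympl : symplectic_form beta)
    (B_good : good_lattice beta varpi lambda B)
    (B_dim : quot_dim (dual_lattice beta varpi lambda B) B (2 * l))
    (A_self_dual : self_dual_lattice beta varpi lambda A)
    (sub_BA : B `<=` A)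
    (sub_AB : A `<=` dual_lattice beta varpi lambda B) :
  let G := P_B beta A B in
  let E := E_ varpi lambda psi beta A B in
  let Es := Epm varpi lambda psi beta A B in
  let V := label_space varpi lambda psi beta A B in
  let M := @M_ R k (2 * r) in
  let Mrep := subrep varpi lambda psi beta A B M in
  let Srep := subrep varpi lambda psi beta A B in
  let z := zeta R A B in
  let chi := chi_pm psi beta A B in
  let Pt := Ptilde_v beta A B in
  let D := layer varpi lambda beta A B in
  (* (i) *)
  [/\ hilbert_sum (Hform A) (Hspace psi beta A)
        (fun mj : nat * layer_index => E mj.1 mj.2),
      nonzero_space (E 0%N j0),
      forall (m : nat) (s : bool), (1 <= m)%N ->
        nonzero_space (Es m j0 s) <-> (0 < l)%N,
      forall (m : nat) (s : bool), nonzero_space (Es m j2 s) <-> (0 < l)%N &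
      forall (m : nat) (s : bool), nonzero_space (Es m j1 s) <-> (l < r)%N]
  /\
  (* (ii) *)
  [/\ forall x, valid_label x -> nonzero_space (V x) ->
        [/\ rep_invariant G M (V x), rep_irreducible G (Mrep x)
          & rep_monomial G (Mrep x)],
      forall x y, valid_label x -> valid_label y ->
        nonzero_space (V x) -> nonzero_space (V y) -> x <> y ->
        ~ rep_equivalent G (Mrep x) (Mrep y),
      rep_equivalent G (Mrep L00) (one_dim_rep (fun=> 1)) &
      forall (m : nat) (j : layer_index) (s : bool) v,
        valid_label (Lpm m j s) -> D m j v ->
        rep_equivalent G (Mrep (Lpm m j s)) (Ind G (Pt v) (chi v s))]
  /\
  (* (iii) *)
  forall S : 'M[k]_(2 * r) ->
      ('cV[k]_(2 * r) -> R[i]) -> ('cV[k]_(2 * r) -> R[i]),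
  weil_lift psi beta A B S ->
  [/\ forall x, valid_label x -> nonzero_space (V x) ->
        rep_invariant G S (V x) /\ rep_irreducible G (Srep S x),
      forall x y, valid_label x -> valid_label y ->
        nonzero_space (V x) -> nonzero_space (V y) -> x <> y ->
        ~ rep_equivalent G (Srep S x) (Srep S y),
      rep_equivalent G (Srep S L00) (one_dim_rep z) &
      forall (m : nat) (j : layer_index) (s : bool) v,
        valid_label (Lpm m j s) -> D m j v ->
        rep_equivalent G (Srep S (Lpm m j s))
          (Ind G (Pt v) (fun g => z g * chi v s g))].
Proof.
move=> G E Es V M Mrep Srep z chi Pt D.
have decomposition act z' :=
  @unitary_twist_decomposition k (2 * r) beta beta_sympl varpi lambda
    varpi_unif A B B_good A_self_dual sub_BA sub_AB R psi char_res psi_char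
    psi_cond act z'.
have nonzero m j s : (0 < rank m j)%N ->
    nonzero_space (Es m j s) <-> if j is j1 then (l < r)%N else (0 < l)%N.
  by rewrite -[(l < r)%N](@ltn_pmul2l 2) //; apply: nonzero_Epm.
split; last split.
- split; [exact: hilbert_sum_E|exact: nonzero_E00| | |] => m s; last 2 first.
  + by apply: nonzero; rewrite /rank; lia.
  + by apply: nonzero; rewrite /rank; lia.
  + by move=> m_gt0; apply: nonzero; rewrite /rank; lia.
- have [irr ineq L00_triv ind] := decomposition M _ (unitary_twist_M _ _ _ _).
  split=> // [x vx nz|m j s v vx Dv].
    by have [invV irrV] := irr x vx nz; split=> //; apply: label_M_monomial.
  have -> : chi v s = (fun g => 1 * chi v s g).
    by apply/funext => g; rewrite mul1r.
  exact: ind.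
- move=> S weil_S; apply: decomposition.
  exact: (unitary_twist_weil beta_sympl varpi_unif _ A_self_dual _ _ char_res
    psi_char psi_cond weil_S).
Qed.
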